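(* Let $G$ be a Lie group with identity $e$ and let $G_+,G_-$ be two Lie subgroups of $G$ such that $G=G_+G_-$ and $G_+\cap G_-=\{e\}$. Define $\mathfrak{B}:G\to G$ by $\mathfrak{B}(g)=g_-^{-1}$ for $g=g_+g_-$, where $g_+\in G_+$, $g_-\in G_-$. Then $(G,\mathfrak{B})$ is a Rota-Baxter Lie group.
   Context: For a group $G$, $\mathrm{Ad}_g h:=ghg^{-1}$. A Rota-Baxter Lie group is a Lie group $G$ with a smooth map $\mathfrak{B}:G\to G$ such that $\mathfrak{B}(g_1)\mathfrak{B}(g_2)=\mathfrak{B}(g_1\,\mathrm{Ad}_{\mathfrak{B}(g_1)}g_2)$ for all $g_1,g_2\in G$. *)

(* Defs.v *)
From HB Require Import structures.
From mathcomp Require Import all_boot all_order all_algebra.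
From mathcomp Require Import all_classical all_reals all_analysis.
Import numFieldNormedType.Exports.

Set Implicit Arguments.
Unset Strict Implicit.
Unset Printing Implicit Defensive.

Local Open Scope classical_set_scope.
Local Open Scope ring_scope.

(* Smoothness is only meant for maps on an open set U of R^n; the functions are
   total, but for open U the definitions below depend only on values on U. *)
Fixpoint Ck (R : realType) (n m k : nat) (U : set 'rV[R]_n)
    (f : 'rV[R]_n -> 'rV[R]_m) : Prop :=
  {in U, continuous f} /\
  if k is k'.+1 then
    forall j : 'I_n, {in U, forall x, derivable f x (delta_mx 0 j)} /\
      Ck k' U (fun x => 'D_(delta_mx 0 j) f x)
  else True.

Definition smooth_on (R : realType) (n m : nat) (U : set 'rV[R]_n)
    (f : 'rV[R]_n -> 'rV[R]_m) : Prop :=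
  forall k, Ck k U f.

(* A chart is the homeomorphism cmap : cdom -> cmap @` cdom with inverse cinv;
   cmap outside cdom and cinv outside the image are junk. *)
Record chart (R : realType) (n : nat) (M : Type) := Chart {
  cdom : set M;
  cmap : M -> 'rV[R]_n;
  cinv : 'rV[R]_n -> M }.

Definition cimg (R : realType) (n : nat) (M : Type) (c : chart R n M)
    (V : set M) : set 'rV[R]_n :=
  cmap c @` (cdom c `&` V).

Definition is_chart (R : realType) (n : nat) (M : topologicalType)
    (c : chart R n M) : Prop :=
  [/\ open (cdom c), open (cimg c setT),
      {in cdom c, cancel (cmap c) (cinv c)},
      {in cdom c, continuous (cmap c)} &
      {in cimg c setT, continuous (cinv c)}].

Definition is_smooth_atlas (R : realType) (n : nat) (M : topologicalType)
    (A : set (chart R n M)) : Prop :=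
  [/\ forall c, A c -> is_chart c,
      forall x, exists2 c, A c & cdom c x &
      forall c d, A c -> A d ->
        smooth_on (cimg c (cdom d)) (cmap d \o cinv c)].

HB.mixin Record isManifold (R : realType) (n : nat) M of Topological M := {
  atlas : set (chart R n M);
  atlas_smooth : is_smooth_atlas atlas;
  manifold_hausdorff : hausdorff_space M;
  manifold_second_countable : @second_countable M }.

#[short(type="manifoldType")]
HB.structure Definition Manifold (R : realType) (n : nat) :=
  { M of Topological M & isManifold R n M }.

Definition smooth_wrt (R : realType) (n m : nat) (M N : topologicalType)
    (A : set (chart R n M)) (B : set (chart R m N)) (f : M -> N) : Prop :=
  continuous f /\
  forall c d, A c -> B d ->
    smooth_on (cimg c (f @^-1` cdom d)) (cmap d \o f \o cinv c).

Definition prod_chart (R : realType) (n m : nat) (M N : Type)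
    (c : chart R n M) (d : chart R m N) : chart R (n + m) (M * N) :=
  Chart (cdom c `*` cdom d)
        (fun p => row_mx (cmap c p.1) (cmap d p.2))
        (fun v => (cinv c (lsubmx v), cinv d (rsubmx v))).

Definition prod_atlas (R : realType) (n m : nat) (M N : Type)
    (A : set (chart R n M)) (B : set (chart R m N)) :
    set (chart R (n + m) (M * N)) :=
  [set e | exists c d, [/\ A c, B d & e = prod_chart c d]].

Definition smooth (R : realType) (n m : nat)
    (M : manifoldType R n) (N : manifoldType R m) (f : M -> N) : Prop :=
  smooth_wrt (@atlas R n M) (@atlas R m N) f.

Definition immersion (R : realType) (n m : nat)
    (M : manifoldType R n) (N : manifoldType R m) (f : M -> N) : Prop :=
  smooth f /\
  forall c d, @atlas R n M c -> @atlas R m N d ->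
    forall x, cdom c x -> cdom d (f x) ->
      injective ('d (cmap d \o f \o cinv c) (cmap c x)).

HB.mixin Record isLieGroup (R : realType) (n : nat) G
    of Manifold R n G & Group G := {
  lie_mul_smooth :
    smooth_wrt (prod_atlas (@atlas R n G) (@atlas R n G)) (@atlas R n G)
      (fun p : G * G => (p.1 * p.2)%g);
  lie_inv_smooth :
    smooth_wrt (@atlas R n G) (@atlas R n G) (fun x : G => (x^-1)%g) }.

#[short(type="lieGroupType")]
HB.structure Definition LieGroup (R : realType) (n : nat) :=
  { G of Manifold R n G & Group G & isLieGroup R n G }.

(* Lie subgroups are immersed, not necessarily embedded or closed. *)
Definition lie_subgroup (R : realType) (n : nat) (G : lieGroupType R n)
    (S : set G) : Prop :=
  exists (k : nat) (H : lieGroupType R k) (phi : H -> G),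
    [/\ {morph phi : x y / (x * y)%g}, injective phi, immersion phi &
        range phi = S].

(* MathComp's own x ^ y is y^-1 * x * y, i.e. Ad (y^-1) x. *)
Definition Ad (G : groupType) (g h : G) : G := (g * h * g^-1)%g.

(* The element g_- of a factorization g = g_+ g_- (junk when there is none);
   it is unique as soon as Gplus and Gminus are subgroups meeting in {1}. *)
Definition minus_part (G : groupType) (Gplus Gminus : set G) (g : G) : G :=
  xget 1%g [set gm | Gminus gm /\ exists2 gp, Gplus gp & g = (gp * gm)%g].

Definition rota_baxter_lie_group (R : realType) (n : nat)
    (G : lieGroupType R n) (B : G -> G) : Prop :=
  smooth B /\
  forall g1 g2 : G, (B g1 * B g2)%g = B (g1 * Ad (B g1) g2)%g.

(* Main.v *)
Require Import Defs.
From HB Require Import structures.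
From mathcomp Require Import all_boot all_order all_algebra.
From mathcomp Require Import all_classical all_reals all_analysis.
From mathcomp Require Import ring lra.
Import Order.TTheory GRing.Theory Num.Theory.
Import numFieldNormedType.Exports.

Set Implicit Arguments.
Unset Strict Implicit.
Unset Printing Implicit Defensive.

Local Open Scope classical_set_scope.
Local Open Scope ring_scope.

(** The algebra is short: if [g1 = a1 b1] and [g2 = a2 b2] with [a1, a2] in [G+]
    and [b1, b2] in [G-], then [B(g1) = b1^-1], so
    [g1 Ad_(B(g1)) g2 = a1 b1 b1^-1 a2 b2 b1 = (a1 a2)(b2 b1)], and [B] sends
    this to [(b2 b1)^-1 = B(g1) B(g2)].

    The real content is that [B] is smooth.  Write [G+] and [G-] as the images
    of injective smooth homomorphisms [phi1 : H1 -> G] and [phi2 : H2 -> G].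
    The hypotheses say that [(a, b) |-> phi1 a phi2 b] is a smooth bijection
    from [H1 x H2] to [G]; a smooth inverse has to be found.

    - Somewhere the differential of this bijection is injective
      ([injective_full_rank]).  At a point where its rank is maximal the rank is
      locally constant, so if the kernel were not zero the inverse function
      theorem would provide a curve tangent to the kernels, along which the map
      would be constant, contrary to injectivity.
    - At that point it is also onto.  By the Baire category theorem and second
      countability of [H1] and [H2], the image of any compact neighbourhood has
      an interior point, because countably many translates of it cover [G]
      ([product_has_interior]).  Let [J] be the matrix of the differential,
      acting on row vectors, and [A] a matrix with [J A = 1].  The map followed
      by [A] is still injective near the point.  If [w A = 0] with [w <> 0],
      this is impossible, since an open subset of the image contains points
      that differ by a multiple of [w].  So [A], and hence [J], is
      invertible.
    - Hence the inverse function theorem, which is proved here for maps of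
      class C^k by Banach's fixed point theorem, gives a smooth local inverse
      near one point of [G] ([local_section]).
    - The identity [B(p g q) = q^-1 B(g)] for [p] in [G+] and [q] in [G-]
      transports smoothness to every point, because the maps [g |-> p g q] act
      transitively ([smooth_minus_partV]).

    Smoothness on manifolds is handled through plots, that is, smooth maps
    from open subsets of R^N: a map is smooth as soon as its composites with
    inverse charts are plots ([smooth_of_plots]), so that the product manifold
    [H1 x H2] never has to be formed. *)

(** * Functions of class C^k *)

Section Ck_calculus.
Variables (R : realType) (n : nat).
Notation V := 'rV[R]_n.

(** The recursion of [Ck] with values in any normed module, so that coordinates
    and row-vector-valued functions are treated by the same lemmas. *)
Fixpoint ck (W : normedModType R) (k : nat) (U : set V) (f : V -> W) : Prop :=
  {in U, continuous f} /\
  if k is k'.+1 then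
    forall j : 'I_n, {in U, forall x, derivable f x (delta_mx 0 j)} /\
      ck k' U (fun x => 'D_(delta_mx 0 j) f x)
  else True.

Lemma ckE m k U (f : V -> 'rV[R]_m) : ck k U f = Ck k U f.
Proof.
by elim: k f => [|k IH] f //=; congr (_ /\ _);
  apply: eq_forall => j; rewrite IH.
Qed.

Lemma ck_continuous (W : normedModType R) k U (f : V -> W) x :
  ck k U f -> U x -> {for x, continuous f}.
Proof. by case: k => [|k] [cf _] Ux; apply: cf; rewrite inE. Qed.

Lemma ck_derivable (W : normedModType R) k U (f : V -> W) x j :
  ck k.+1 U f -> U x -> derivable f x (delta_mx 0 j).
Proof. by move=> [_ /(_ j)[df _]] Ux; apply: df; rewrite inE. Qed.

Lemma ck_derive (W : normedModType R) k U (f : V -> W) j :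
  ck k.+1 U f -> ck k U ('D_(delta_mx 0 j) f).
Proof. by move=> [_ /(_ j)[]]. Qed.

Lemma ckS (W : normedModType R) k U (f : V -> W) : ck k.+1 U f -> ck k U f.
Proof.
elim: k f => [|k IH] f [cf df]; split=> // j.
by have [dfj ?] := df j; split=> //; apply: IH.
Qed.

Lemma sub_ck (W : normedModType R) k U U' (f : V -> W) :
  U' `<=` U -> ck k U f -> ck k U' f.
Proof.
move=> UU'; elim: k f => [|k IH] f [cf df].
  by split=> // x; rewrite inE => /UU' Ux; apply: cf; rewrite inE.
split=> [x|j]; first by rewrite inE => /UU' Ux; apply: cf; rewrite inE.
have [dfj ?] := df j; split; last exact: IH.
by move=> x; rewrite inE => /UU' Ux; apply: dfj; rewrite inE.
Qed.

(** Being C^k is a pointwise condition on total derivative functions, so local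
    witnesses need not be glued. *)
Lemma ck_local (W : normedModType R) k U (f : V -> W) :
  (forall x, U x -> exists2 U', U' x & ck k U' f) -> ck k U f.
Proof.
elim: k f => [|k IH] f H.
  by split=> // x; rewrite inE => /H[U' Ux /ck_continuous]; apply.
split=> [x|j]; first by rewrite inE => /H[U' Ux /ck_continuous]; apply.
split=> [x|]; first by rewrite inE => /H[U' Ux /ck_derivable]; apply.
by apply: IH => x /H[U' Ux /ck_derive]; exists U'.
Qed.

Lemma open_near_eq (W : Type) (U : set V) (f g : V -> W) x :
  open U -> U x -> (forall y, U y -> f y = g y) -> \near x, f x = g x.
Proof. by move=> oU Ux fg; apply: filterS (open_nbhs_nbhs (conj oU Ux)). Qed.

Lemma eq_ck (W : normedModType R) k U (f g : V -> W) :
  open U -> (forall x, U x -> f x = g x) -> ck k U f -> ck k U g.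
Proof.
move=> oU; elim: k f g => [|k IH] f g fg [cf df].
  split=> // x; rewrite inE => Ux; rewrite /continuous_at -fg //.
  apply: cvg_trans (cf x _); last by rewrite inE.
  exact: near_eq_cvg (open_near_eq oU Ux fg).
split=> [x|j].
  rewrite inE => Ux; rewrite /continuous_at -fg //.
  apply: cvg_trans (cf x _); last by rewrite inE.
  exact: near_eq_cvg (open_near_eq oU Ux fg).
have [dfj dk] := df j; split=> [x|].
  rewrite inE => Ux; apply: near_eq_derivable (open_near_eq oU Ux fg) _.
  by apply: dfj; rewrite inE.
apply: IH dk => x Ux; exact: near_eq_derive (open_near_eq oU Ux fg).
Qed.

Lemma ck_cst (W : normedModType R) k U (a : W) : ck k U (cst a).
Proof.
elim: k a => [|k IH] a; first by split=> // x _; exact: cst_continuous.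
split=> [x _|j]; first exact: cst_continuous.
split=> [x _|]; first exact: derivable_cst.
rewrite (_ : (fun x => _) = cst 0) //.
by apply/funext => x; rewrite derive_cst.
Qed.

Lemma ckD (W : normedModType R) k U (f g : V -> W) :
  open U -> ck k U f -> ck k U g -> ck k U (fun x => f x + g x).
Proof.
move=> oU; elim: k f g => [|k IH] f g [cf df] [cg dg].
  by split=> // x Ux; apply: continuousD (cf x Ux) (cg x Ux).
split=> [x Ux|j]; first by apply: continuousD (cf x Ux) (cg x Ux).
have [dfj fk] := df j; have [dgj gk] := dg j.
split=> [x Ux|]; first by apply: derivableD; [apply: dfj|apply: dgj].
apply: eq_ck oU _ (IH _ _ fk gk) => x; rewrite -inE => Ux.
by rewrite [RHS]deriveD //; [apply: dfj|apply: dgj].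
Qed.

Lemma ckM k U (f g : V -> R) :
  open U -> ck k U f -> ck k U g -> ck k U (fun x => f x * g x).
Proof.
move=> oU; elim: k f g => [|k IH] f g ckf ckg; have [cf df] := ckf; have [cg dg] := ckg.
  by split=> // x Ux; apply: continuousM (cf x Ux) (cg x Ux).
split=> [x Ux|j]; first by apply: continuousM (cf x Ux) (cg x Ux).
have [dfj fk] := df j; have [dgj gk] := dg j.
split=> [x Ux|]; first by apply: derivableM; [apply: dfj|apply: dgj].
apply: eq_ck oU _ (ckD oU (IH _ _ (ckS ckf) gk) (IH _ _ (ckS ckg) fk)) => x.
rewrite -inE => Ux.
by rewrite [RHS]deriveM //; [apply: dfj|apply: dgj].
Qed.

Lemma ckV k U (f : V -> R) :
  open U -> (forall x, U x -> f x != 0) -> ck k U f ->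
  ck k U (fun x => (f x)^-1).
Proof.
move=> oU f0; elim: k => [|k IH] ckf; have [cf df] := ckf.
  by split=> // x Ux; apply: continuousV (cf x Ux); apply: f0; rewrite -inE.
split=> [x Ux|j]; first by apply: continuousV (cf x Ux); apply: f0; rewrite -inE.
have [dfj fk] := df j.
split=> [x Ux|]; first by apply: derivableV; [apply: f0; rewrite -inE|apply: dfj].
have ckVf := IH (ckS ckf).
apply: eq_ck oU _ (ckM oU (ck_cst k U (-1 : R)) (ckM oU (ckM oU ckVf ckVf) fk)) => x Ux.
rewrite [RHS]deriveV //; [|exact: f0|by apply: dfj; rewrite inE].
by rewrite mulN1r -expr2 exprVn scaleNr.
Qed.

Lemma ck_sum (I : Type) (r : seq I) (P : pred I) k U (F : I -> V -> R) :
  open U -> (forall i, ck k U (F i)) ->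
  ck k U (fun x => \sum_(i <- r | P i) F i x).
Proof.
move=> oU HF; elim: r => [|i r IH].
  by rewrite (_ : (fun x => _) = cst 0) ?funeqE => [|x]; [exact: ck_cst|rewrite big_nil].
rewrite (_ : (fun x => _) = (fun x => (if P i then F i x else 0) +
    \sum_(i <- r | P i) F i x)); last first.
  by apply/funext => x; rewrite big_cons; case: ifP; rewrite ?add0r.
by apply: ckD => //; case: (P i); [exact: HF|exact: ck_cst].
Qed.

Lemma ck_prod (I : Type) (r : seq I) (P : pred I) k U (F : I -> V -> R) :
  open U -> (forall i, ck k U (F i)) ->
  ck k U (fun x => \prod_(i <- r | P i) F i x).
Proof.
move=> oU HF; elim: r => [|i r IH].
  by rewrite (_ : (fun x => _) = cst 1) ?funeqE => [|x]; [exact: ck_cst|rewrite big_nil].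
rewrite (_ : (fun x => _) = (fun x => (if P i then F i x else 1) *
    \prod_(i <- r | P i) F i x)); last first.
  by apply/funext => x; rewrite big_cons; case: ifP; rewrite ?mul1r.
by apply: ckM => //; case: (P i); [exact: HF|exact: ck_cst].
Qed.

Lemma ck_det p k U (A : V -> 'M[R]_p) : open U ->
  (forall i j, ck k U (fun x => A x i j)) -> ck k U (fun x => \det (A x)).
Proof.
move=> oU HA; apply: ck_sum => // s; apply: ckM => //; first exact: ck_cst.
by apply: ck_prod => // i; apply: HA.
Qed.

Lemma ck_invmx p k U (A : V -> 'M[R]_p) i j : open U ->
  (forall x, U x -> A x \in unitmx) ->
  (forall i j, ck k U (fun x => A x i j)) -> ck k U (fun x => invmx (A x) i j).
Proof.
move=> oU uA HA.
have ck_adj : ck k U (fun x => \adj (A x) i j).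
  rewrite (_ : (fun x => _) = (fun x => (-1) ^+ (j + i) * \det (row' j (col' i (A x))))).
    apply: ckM => //; first exact: ck_cst.
    apply: ck_det => // a b; rewrite (_ : (fun x => _) = (fun x => A x (lift j a) (lift i b))) //.
    by apply/funext => x; rewrite !mxE.
  by apply/funext => x; rewrite mxE.
have ckVd : ck k U (fun x => (\det (A x))^-1).
  apply: ckV => // [x /uA|]; first by rewrite unitmxE unitfE.
  exact: ck_det.
refine (eq_ck oU _ (ckM oU ckVd ck_adj)) => x /uA Ax.
by rewrite /invmx Ax [RHS]mxE.
Qed.

Lemma mx_cvgP (T : Type) (F : set_system T) (FF : Filter F) m1 m2
    (f : T -> 'M[R]_(m1, m2)) (l : 'M[R]_(m1, m2)) :
  (forall i j, (fun x => f x i j) @ F --> l i j) -> f @ F --> l.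
Proof.
move=> H; apply/cvgrPdist_lt => e e0.
have : \forall x \near F, forall ij : 'I_m1 * 'I_m2, `|l ij.1 ij.2 - f x ij.1 ij.2| < e.
  by apply: filter_forall => ij; move/cvgrPdist_lt: (H ij.1 ij.2); apply.
apply: filterS => x Hx; rewrite [ltLHS]/Num.Def.normr/= mx_normrE.
by apply/bigmax_ltP; split=> //= -[a b] _; rewrite !mxE; exact: (Hx (a, b)).
Qed.

Lemma continuous_mx (T : topologicalType) m1 m2 (f : T -> 'M[R]_(m1, m2)) x :
  (forall i j, {for x, continuous (fun y => f y i j)}) ->
  {for x, continuous f}.
Proof. by move=> cf; apply: mx_cvgP => i j; apply: cf. Qed.

(** This reduction to coordinates is what lets the ring operations on
    real-valued functions serve matrix-valued expressions. *)
Lemma ck_rowP m k U (f : V -> 'rV[R]_m) : open U ->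
  ck k U f <-> forall i, ck k U (fun x => f x 0 i).
Proof.
move=> oU; elim: k f => [|k IH] f.
  split=> [[cf _] i|H].
    split=> // x Ux; apply: (@continuous_comp _ _ _ f (fun M : 'rV[R]_m => M 0 i)).
      exact: cf.
    exact: coord_continuous.
  split=> // x Ux; apply: continuous_mx => i j; rewrite (ord1 i).
  by have [+ _] := H j => /(_ x Ux).
split=> [ckf i|H].
  have [cf df] := ckf; split=> [x Ux|j].
    apply: (@continuous_comp _ _ _ f (fun M : 'rV[R]_m => M 0 i)).
      exact: cf.
    exact: coord_continuous.
  have [dfj fk] := df j; split=> [x Ux|].
    by apply: (derivable_mxP _ _ _).1; apply: dfj.
  apply: eq_ck oU _ ((IH _).1 fk i) => x; rewrite -inE => Ux.
  by rewrite derive_mx ?mxE //; apply: dfj.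
have dfj j x : U x -> derivable f x (delta_mx 0 j).
  move=> Ux; apply/derivable_mxP => a b; rewrite (ord1 a).
  exact: (ck_derivable (H b) Ux).
split=> [x Ux|j].
  apply: continuous_mx => i j; rewrite (ord1 i).
  by have [+ _] := H j => /(_ x Ux).
split=> [x|]; first by rewrite inE; apply: dfj.
apply/IH => i; apply: eq_ck oU _ (ck_derive j (H i)) => x Ux.
by rewrite derive_mx ?mxE //; apply: dfj.
Qed.

End Ck_calculus.

Section Ck_linear.
Variables (R : realType) (n : nat).
Notation V := 'rV[R]_n.

Lemma ck_id k (U : set V) : open U -> ck k U (@id V).
Proof.
move=> oU; case: k => [|k]; first by split=> // x _; apply: cvg_id.
split=> [x _|j]; first exact: cvg_id.
split=> [x _|]; first exact: derivable_id.
by apply: eq_ck oU _ (ck_cst k U (delta_mx 0 j : V)) => x _; rewrite derive_id.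
Qed.

Lemma ck_mulmxr m p k (U : set V) (f : V -> 'rV[R]_m) (A : 'M[R]_(m, p)) : open U ->
  ck k U f -> ck k U (fun x => f x *m A).
Proof.
move=> oU /(ck_rowP _ _ oU) ckf; apply/ck_rowP => // i.
rewrite (_ : (fun x => _) = (fun x => \sum_j f x 0 j * A j i)).
  by apply: ck_sum => // j; apply: ckM => //; exact: ck_cst.
by apply/funext => x; rewrite mxE.
Qed.

Lemma ck_lsubmx m1 m2 k (U : set V) (f : V -> 'rV[R]_(m1 + m2)) : open U ->
  ck k U f -> ck k U (fun x => lsubmx (f x)).
Proof.
move=> oU /(ck_rowP _ _ oU) ckf; apply/ck_rowP => // i.
rewrite (_ : (fun x => _) = (fun x => f x 0 (lshift m2 i))) //.
by apply/funext => x; rewrite mxE.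
Qed.

Lemma ck_rsubmx m1 m2 k (U : set V) (f : V -> 'rV[R]_(m1 + m2)) : open U ->
  ck k U f -> ck k U (fun x => rsubmx (f x)).
Proof.
move=> oU /(ck_rowP _ _ oU) ckf; apply/ck_rowP => // i.
rewrite (_ : (fun x => _) = (fun x => f x 0 (rshift m1 i))) //.
by apply/funext => x; rewrite mxE.
Qed.

Lemma ck_row_mx m1 m2 k (U : set V) (f : V -> 'rV[R]_m1) (g : V -> 'rV[R]_m2) :
  open U -> ck k U f -> ck k U g -> ck k U (fun x => row_mx (f x) (g x)).
Proof.
move=> oU /(ck_rowP _ _ oU) ckf /(ck_rowP _ _ oU) ckg; apply/ck_rowP => // i.
case: (split_ordP i) => j ->.
  rewrite (_ : (fun x => _) = (fun x => f x 0 j)) //.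
  by apply/funext => x; rewrite row_mxEl.
rewrite (_ : (fun x => _) = (fun x => g x 0 j)) //.
by apply/funext => x; rewrite row_mxEr.
Qed.

End Ck_linear.

Lemma continuous_mulmxr (R : realType) n m (A : 'M[R]_(n, m)) :
  continuous (fun x : 'rV[R]_n => x *m A).
Proof.
move=> x; apply: (@ck_continuous _ _ _ 0 setT) => //.
by apply: ck_mulmxr; [exact: openT|apply: ck_id; exact: openT].
Qed.

(** * The mean value inequality and the chain rule *)

Lemma is_derive_line (R : realType) (V W : normedModType R) (f : V -> W) z v
    (s : R) :
  derivable f (z + s *: v) v ->
  is_derive s 1 (fun t : R => f (z + t *: v)) ('D_v f (z + s *: v)).
Proof.
have E : (fun h : R => h^-1 *:
         (((fun t : R => f (z + t *: v)) \o shift s) (h *: 1) - f (z + s *: v)))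
     = (fun h : R => h^-1 *:
         ((f \o shift (z + s *: v)) (h *: v) - f (z + s *: v))).
  apply/funext => h /=; congr (_ *: (f _ - _)).
  by rewrite [_ *: 1]mulr1 scalerDl addrCA.
by move=> df; split; rewrite /derivable /derive E.
Qed.

Lemma mx_norm_coord (R : realType) m n (x : 'M[R]_(m, n)) i j : `|x i j| <= `|x|.
Proof. by rewrite [leRHS]/Num.Def.normr/= mx_normrE; apply: (le_bigmax _ _ (i, j)). Qed.

Lemma mx_norm_le (R : realType) m n (x : 'M[R]_(m, n)) e : 0 <= e ->
  (forall i j, `|x i j| <= e) -> `|x| <= e.
Proof.
move=> e0 H; rewrite [leLHS]/Num.Def.normr/= mx_normrE.
by apply/bigmax_leP; split=> // ij _; apply: H.
Qed.

Section MeanValue.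
Variables (R : realType) (n : nat).
Implicit Types (f : 'rV[R]_n -> R) (x y z : 'rV[R]_n).

(** The segment stays in the ball because balls of the sup norm are cubes. *)
Lemma mean_value_coord f x0 (r e : R) i z t :
  (forall z, ball x0 r z ->
     derivable f z (delta_mx 0 i) /\ `|'D_(delta_mx 0 i) f z| <= e) ->
  ball x0 r z -> ball x0 r (z + t *: delta_mx 0 i) ->
  `|f (z + t *: delta_mx 0 i) - f z| <= e * `|t|.
Proof.
move=> df.
wlog t0 : z t / 0 <= t => [H|] bz bzt.
  have [/H|/ltW t0] := leP 0 t; first exact.
  have := H (z + t *: delta_mx 0 i) (- t).
  rewrite scaleNr addrK oppr_ge0 => /(_ t0 bzt bz).
  by rewrite distrC normrN.
have bs s : 0 <= s <= t -> ball x0 r (z + s *: delta_mx 0 i).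
  move=> /andP[s0 st]; case: bz bzt => [r0 bz] [_ bzt]; split=> // a j.
  have := bz a j; have := bzt a j; rewrite /ball/= !mxE ord1 eqxx /=.
  case: eqP => [->|_]; rewrite ?mulr0// !mulr1 !ltr_norml.
  by move=> /andP[? ?] /andP[? ?]; apply/andP; split; lra.
have dg s : s \in `[0, t] -> is_derive s 1
    (fun t : R => f (z + t *: delta_mx 0 i)) ('D_(delta_mx 0 i) f (z + s *: delta_mx 0 i)).
  by rewrite in_itv/= => /bs/df[? _]; apply: is_derive_line.
pose g s : R := f (z + s *: delta_mx 0 i).
have [|c cin] := @MVT_segment R g (fun s => 'D_(delta_mx 0 i) f (z + s *: delta_mx 0 i))
    0 t t0 (fun s sin => dg s (subset_itv_oo_cc sin)).
  by apply: derivable_within_continuous => s /dg[].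
rewrite /g scale0r addr0 subr0 => ->; rewrite normrM ler_wpM2r //.
by move: cin; rewrite in_itv/= => /bs/df[].
Qed.

(** Move from [y] to [x] by changing one coordinate at a time: all the
    intermediate points lie in the cube, and each step is one-dimensional. *)
Lemma mean_value_ball f x0 (r e : R) x y :
  (forall z, ball x0 r z -> forall i,
     derivable f z (delta_mx 0 i) /\ `|'D_(delta_mx 0 i) f z| <= e) ->
  ball x0 r x -> ball x0 r y -> `|f x - f y| <= n%:R * e * `|x - y|.
Proof.
move=> df bx yb.
pose z k : 'rV[R]_n := \row_j if (j < k)%N then x 0 j else y 0 j.
have z0 : z 0 = y by apply/rowP => j; rewrite mxE.
have zn : z n = x by apply/rowP => j; rewrite mxE ltn_ord.
have bz k : ball x0 r (z k).
  case: bx yb => r0 bx [_ yb]; split=> // a j; rewrite (ord1 a) mxE.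
  by case: ifP => _; [exact: bx|exact: yb].
have zS (k : 'I_n) : z k.+1 = z k + (x 0 k - y 0 k) *: delta_mx 0 k.
  apply/rowP => j; rewrite !mxE eqxx /= -val_eqE /= ltnS leq_eqVlt.
  by case: ltngtP => //= [| |/val_inj->]; rewrite ?mulr0 ?addr0 // mulr1 addrC subrK.
have -> : f x - f y = \sum_(k < n) (f (z k.+1) - f (z k)).
  by rewrite -(big_mkord xpredT (fun k => f (z k.+1) - f (z k))) telescope_sumr // z0 zn.
have -> : n%:R * e * `|x - y| = \sum_(k < n) (e * `|x - y|).
  by rewrite sumr_const card_ord -mulrA mulr_natl.
apply: le_trans (ler_norm_sum _ _ _) _; apply: ler_sum => k _.
have bk := bz k.+1; rewrite zS in bk *.
apply: (le_trans (mean_value_coord (r := r) (x0 := x0) (e := e) _ (bz k) bk)).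
  by move=> w /df.
have e0 : 0 <= e by have [_] := df _ (bz 0) k; exact: le_trans.
rewrite ler_wpM2l //; have := mx_norm_coord (x - y) 0 k; by rewrite !mxE.
Qed.

End MeanValue.

Section Chain.
Variables (R : realType).

Lemma is_derive_linear (V W : normedModType R) (L : {linear V -> W}) (z v : V) :
  is_derive z v L (L v).
Proof.
have H : \forall h \near 0^', h^-1 *: ((L \o shift z) (h *: v) - L z) = L v.
  near=> h.
  have h0 : h != 0 :> R by near: h; exact: nbhs_dnbhs_neq.
  rewrite /= [L (_ + _)]raddfD addrK; transitivity (h^-1 *: (h *: L v)).
    by congr (_ *: _); exact: linearZ.
  by rewrite scalerA mulVf ?scale1r.
by split; [apply: is_cvg_near_cst H|apply: lim_near_cst H].
Unshelve. all: by end_near. Qed.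

(** The Jacobian acts on row vectors from the right, as in [jacobian], but it is
    built from partial derivatives and so makes sense before
    differentiability is known. *)
Definition partials n m (f : 'rV[R]_n -> 'rV[R]_m) x : 'M[R]_(n, m) :=
  \matrix_(i, j) ('D_(delta_mx 0 i) f x) 0 j.

(** The mean value inequality applied to [f] minus its linear part at [x0].  The
    estimate is uniform in both points, which gives differentiability when
    [y = x0] and the contraction property in the inverse function theorem. *)
Lemma C1_strict n m (U : set 'rV[R]_n) (f : 'rV[R]_n -> 'rV[R]_m) x0 e :
  open U -> U x0 -> ck 1 U f -> 0 < e ->
  exists r : R, [/\ 0 < r, ball x0 r `<=` U &
   (forall z, ball x0 r z -> forall i j, `|partials f z i j - partials f x0 i j| <= e) /\
   forall x y, ball x0 r x -> ball x0 r y ->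
    `|f x - f y - (x - y) *m partials f x0| <= n%:R * e * `|x - y|].
Proof.
move=> oU Ux0 ckf e0.
have : \forall z \near x0, U z /\ forall i : 'I_n,
    `|'D_(delta_mx 0 i) f x0 - 'D_(delta_mx 0 i) f z| < e.
  apply: filterI (open_nbhs_nbhs (conj oU Ux0)) _.
  apply: (@filter_forall _ _ _ (nbhs x0)) => i.
  have := ck_continuous (ck_derive i ckf) Ux0.
  by move/cvgrPdist_lt; apply.
move=> /nbhs_ballP[r /= r0 Hr].
have close z i j : ball x0 r z -> `|partials f z i j - partials f x0 i j| <= e.
  move=> bz; have [_ /(_ i) Hz] := Hr _ bz; apply: ltW.
  apply: le_lt_trans Hz; rewrite distrC.
  by have := mx_norm_coord ('D_(delta_mx 0 i) f x0 - 'D_(delta_mx 0 i) f z) 0 j; rewrite !mxE.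
exists r; split=> //; first by move=> z /Hr[].
split=> [z bz i j|]; first exact: close.
move=> x y bx yb; apply: mx_norm_le => [|a j].
  by rewrite !mulr_ge0 // ltW.
pose L := (fun z : 'rV[R]_n => (z *m partials f x0) 0 j).
pose g z := f z 0 j - L z.
have -> : (f x - f y - (x - y) *m partials f x0) a j = g x - g y.
  have E (u v w s : 'rV[R]_m) : (u - v - (w - s)) 0 j = u 0 j - w 0 j - (v 0 j - s 0 j).
    by rewrite !mxE; lra.
  by rewrite (ord1 a) mulmxBl E.
apply: (mean_value_ball (x0 := x0) (r := r)) => // z bz i.
have [Uz _] := Hr z bz.
have dfz : is_derive z (delta_mx 0 i) (fun z => f z 0 j) (partials f z i j).
  have df := ck_derivable (j := i) ckf Uz.
  split; first exact: (derivable_mxP _ _ _).1.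
  by rewrite mxE derive_mx // mxE.
have linL : linear L.
  by move=> a' u v; rewrite /L mulmxDl -scalemxAl !mxE.
pose mL := GRing.isLinear.Build _ _ _ _ L linL.
pose LL : {linear 'rV[R]_n -> R} := HB.pack L mL.
have dL : is_derive z (delta_mx 0 i) L (partials f x0 i j).
  have := is_derive_linear LL z (delta_mx 0 i).
  by rewrite /LL /= {2}/L -rowE [in X in _ -> X]mxE mxE mxE.
have dg : is_derive z (delta_mx 0 i) g (partials f z i j - partials f x0 i j).
  exact: is_deriveB.
by split; [exact: ex_derive|rewrite derive_val; exact: close].
Qed.

End Chain.

Section Composition.
Variable R : realType.

(** Continuous partial derivatives imply differentiability: this makes the chain
    rule available for the class C^k, which only mentions partial
    derivatives. *)
Lemma C1_differentiable n m (U : set 'rV[R]_n) (f : 'rV[R]_n -> 'rV[R]_m) x0 :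
  open U -> U x0 -> ck 1 U f ->
  differentiable f x0 /\ forall v, 'd f x0 v = v *m partials f x0.
Proof.
move=> oU Ux0 ckf.
have linL : linear (fun v : 'rV[R]_n => v *m partials f x0).
  by move=> a u v; rewrite mulmxDl -scalemxAl.
pose L : {linear 'rV[R]_n -> 'rV[R]_m} :=
  HB.pack (fun v : 'rV[R]_n => v *m partials f x0) (GRing.isLinear.Build _ _ _ _ _ linL).
have cL : continuous L by exact: continuous_mulmxr.
have E : f \o shift x0 = cst (f x0) + L +o_ (0 : 'rV[R]_n) id.
  apply/eqaddoP => e e0.
  pose d := e / (n%:R + 1).
  have d0 : 0 < d by rewrite divr_gt0 // ltr_wpDl.
  have [r [r0 _ [_ Hr]]] := C1_strict oU Ux0 ckf d0.
  near=> h.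
  have bh : ball x0 r (h + x0).
    rewrite -ball_normE /ball_ /= opprD addrCA subrr addr0 normrN.
    near: h; exact: (@nbhs0_lt _ 'rV[R]_n).
  have := Hr _ _ bh (ballxx _ r0).
  rewrite addrK => H; apply: le_trans (_ : n%:R * d * `|h| <= _).
    move: H; rewrite -[X in _ -> `|X| <= _]/(f (h + x0) - (f x0 + h *m partials f x0)).
    by rewrite opprD addrA.
  rewrite ler_wpM2r // /d mulrCA ler_piMr ?(ltW e0) // ler_pdivrMr ?mul1r ?ltr_wpDl //.
  by rewrite lerDl.
have dE := diff_unique cL E.
split; last by move=> v; rewrite dE.
by apply/diff_locallyP; rewrite dE.
Unshelve. all: by end_near. Qed.

Lemma derivable_comp n m p (U : set 'rV[R]_m) (f : 'rV[R]_m -> 'rV[R]_p)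
    (g : 'rV[R]_n -> 'rV[R]_m) x v :
  open U -> U (g x) -> ck 1 U f -> derivable g x v ->
  derivable (f \o g) x v /\
  'D_v (f \o g) x = 'D_v g x *m partials f (g x).
Proof.
move=> oU Ug ckf dg.
have [df dfE] := C1_differentiable oU Ug ckf.
pose c (h : R) := g (h *: v + x).
have c0 : c 0 = g x by rewrite /c scale0r add0r.
have cd : derivable c 0 1 := (derivable1P _ _ _).1 dg.
have dc : differentiable c 0 by apply/derivable1_diffP.
have dfc : differentiable f (c 0) by rewrite c0.
have dcomp : differentiable (f \o c) 0 by exact: differentiable_comp.
have D (W : normedModType R) (h : 'rV[R]_n -> W) : 'D_v h x = 'D_1 (fun t : R => h (t *: v + x)) 0.
  rewrite /derive; set g1 := fun t => t^-1 *: _; set g2 := fun t => t^-1 *: _.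
  suff -> : g1 = g2 by []; apply/funext => t; rewrite /g1 /g2 /=.
  by rewrite addr0 scale0r add0r [t *: 1]mulr1.
split; first exact: ((derivable1P _ _ _).2 ((derivable1_diffP _ _).2 dcomp)).
have -> : 'D_v (f \o g) x = 'D_(1 : R) (f \o c) 0 by exact: D.
have -> : 'D_v g x = 'D_(1 : R) c 0 by exact: D.
by rewrite (deriveE (1 : R) dcomp) (deriveE (1 : R) dc) (diff_comp dc dfc) /= c0 dfE.
Qed.

(** Induction on [k]: the partial derivatives of the composite are sums of
    products of functions that are C^k by the induction hypothesis. *)
Lemma ck_comp n m p k (U : set 'rV[R]_n) (U' : set 'rV[R]_m)
    (f : 'rV[R]_m -> 'rV[R]_p) (g : 'rV[R]_n -> 'rV[R]_m) :
  open U -> open U' -> (forall x, U x -> U' (g x)) ->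
  ck k U g -> ck k U' f -> ck k U (f \o g).
Proof.
move=> oU oU' UU'; elim: k f => [|k IH] f ckg ckf.
  split=> // x; rewrite inE => Ux; apply: continuous_comp.
    exact: ck_continuous ckg Ux.
  exact: ck_continuous ckf (UU' _ Ux).
split=> [x|j].
  rewrite inE => Ux; apply: continuous_comp.
    exact: ck_continuous ckg Ux.
  exact: ck_continuous ckf (UU' _ Ux).
have ck1 h q (V : set 'rV[R]_q) (F : 'rV[R]_q -> 'rV[R]_h) : ck k.+1 V F -> ck 1 V F.
  by elim: k {IH ckg ckf} => // k IH /ckS.
split=> [x|].
  rewrite inE => Ux.
  by have [] := derivable_comp oU' (UU' _ Ux) (ck1 _ _ _ _ ckf) (ck_derivable (j := j) ckg Ux).
apply: (eq_ck (f := fun x => 'D_(delta_mx 0 j) g x *m partials f (g x))) => //.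
  move=> x Ux.
  by have [_ ->] := derivable_comp oU' (UU' _ Ux) (ck1 _ _ _ _ ckf) (ck_derivable (j := j) ckg Ux).
apply/ck_rowP => // i.
rewrite (_ : (fun x => _) = (fun x => \sum_a ('D_(delta_mx 0 j) g x) 0 a *
   ('D_(delta_mx 0 a) f \o g) x 0 i)); last first.
  by apply/funext => x; rewrite mxE; apply: eq_bigr => a _; rewrite [X in _ * X]mxE.
apply: ck_sum => // a; apply: ckM => //.
  by move/ck_rowP: (ck_derive j ckg); apply.
by move/ck_rowP: (IH _ (ckS ckg) (ck_derive a ckf)); apply.
Qed.

End Composition.

(** * The inverse function theorem *)

(** Completeness of the matrix space, joined with its normed module structure:
    needed for Banach's fixed point theorem and for Baire's theorem. *)
HB.instance Definition _ (R : realType) (m n : nat) :=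
  Uniform_isComplete.Build 'M[R]_(m, n) cauchy_cvg.

Lemma mulmx_norm_le (R : realType) n m (v : 'rV[R]_n) (A : 'M[R]_(n, m)) e :
  0 <= e -> (forall i j, `|A i j| <= e) -> `|v *m A| <= n%:R * e * `|v|.
Proof.
move=> e0 HA; apply: mx_norm_le => [|a j]; first by rewrite !mulr_ge0.
rewrite (ord1 a) mxE; apply: le_trans (ler_norm_sum _ _ _) _.
have -> : n%:R * e * `|v| = \sum_(k < n) (`|v| * e).
  by rewrite sumr_const card_ord -mulrA mulr_natl [e * _]mulrC.
by apply: ler_sum => k _; rewrite normrM ler_pM // mx_norm_coord.
Qed.

Lemma near_line (R : realType) (V : normedModType R) (y v : V) (r : R) : 0 < r ->
  \forall h \near (0 : R), ball y r (h *: v + y).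
Proof.
move=> r0; near=> h; rewrite -ball_normE /ball_ /= opprD addrCA subrr addr0 normrN.
rewrite normrZ; apply: (@le_lt_trans _ _ (`|h| * (`|v| + 1))).
  by rewrite ler_wpM2l // lerDl.
rewrite -ltr_pdivlMr ?ltr_wpDl //; near: h.
by apply: (@nbhs0_lt _ R^o); rewrite divr_gt0 // ltr_wpDl.
Unshelve. all: by end_near. Qed.

Section InverseFunction.
Variables (R : realType) (n : nat).
Notation V := 'rV[R]_n.

Lemma fixed_point (D : set V) (T : V -> V) : closed D -> D !=set0 ->
  (forall x, D x -> D (T x)) ->
  (forall x y, D x -> D y -> `|T x - T y| <= 2^-1 * `|x - y|) ->
  exists2 x, D x & x = T x.
Proof.
move=> cD D0 DT lipT.
pose f : {fun D >-> D} := HB.pack T (isFun.Build _ _ D D T DT).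
apply: (banach_fixed_point (f := f)) => //.
have h0 : (0 : R) <= 2^-1 by rewrite invr_ge0.
exists (NngNum h0); split=> /=; first by lra.
by move=> [x y] [Dx Dy] /=; exact: lipT.
Qed.

(** With [x_h = G (y + h v)] and [P] the Jacobian of [F] at [G y], strict
    differentiability gives [h v = (x_h - G y) P + o(x_h - G y)], and the
    Lipschitz bound turns the remainder into [o(h)]. *)
Lemma derivable_inverse (U W : set V) (F G : V -> V) (y v : V) :
  open U -> ck 1 U F -> open W -> (forall z, W z -> U (G z) /\ F (G z) = z) ->
  (forall z z', W z -> W z' -> `|G z - G z'| <= 2 * `|z - z'|) ->
  W y -> partials F (G y) \in unitmx ->
  derivable G y v /\ 'D_v G y = v *m invmx (partials F (G y)).
Proof.
move=> oU ckF oW FG lipG Wy uP.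
set P := partials F (G y).
pose q (h : R) : V := h^-1 *: ((G \o shift y) (h *: v) - G y).
suff H : q @ 0^' --> v *m invmx P.
  by split; [apply/cvg_ex; exists (v *m invmx P)|apply: cvg_lim].
have -> : q = (fun x : V => x *m invmx P) \o (fun h => q h *m P).
  by apply/funext => h /=; rewrite mulmxK.
apply: cvg_comp; last exact: continuous_mulmxr.
apply/cvgrPdist_le => e e0.
(* The error at precision [e / N] is at most
   [n (e / N) (2 |h| |v|) <= |h| e]. *)
pose N := 2 * n%:R * `|v| + 1.
have N0 : 0 < N by rewrite ltr_wpDl // !mulr_ge0.
have d0 : 0 < e / N by rewrite divr_gt0.
have [UG _] := FG _ Wy.
have [r [r0 _ [_ Hr]]] := C1_strict oU UG ckF d0.
have /nbhs_ballP[s /= s0 sW] : nbhs y W by exact: open_nbhs_nbhs.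
near=> h.
have h0 : h != 0 :> R by near: h; exact: nbhs_dnbhs_neq.
have bh : ball y s (h *: v + y) by near: h; apply: nbhs_dnbhs; exact: near_line.
have bh2 : ball y (r / 2) (h *: v + y).
  by near: h; apply: nbhs_dnbhs; apply: near_line; rewrite divr_gt0.
have Wh := sW _ bh.
have lip : `|G (h *: v + y) - G y| <= 2 * (`|h| * `|v|).
  by have := lipG _ _ Wh Wy; rewrite addrK normrZ.
have bG : ball (G y) r (G (h *: v + y)).
  move: bh2; rewrite -!ball_normE /ball_ /= opprD addrCA subrr addr0 normrN normrZ => bh2.
  by rewrite distrC; apply: le_lt_trans lip _; lra.
have := Hr _ _ bG (ballxx _ r0).
have [_ ->] := FG _ Wh; have [_ ->] := FG _ Wy; rewrite addrK -/P => H.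
have -> : v - q h *m P = h^-1 *: (h *: v - (G (h *: v + y) - G y) *m P).
  by rewrite /q -scalemxAl scalerBr scalerA mulVf // scale1r.
rewrite normrZ normfV.
rewrite ler_pdivrMl ?normr_gt0 //.
apply: le_trans H _; apply: le_trans (ler_wpM2l _ lip) _.
  by rewrite mulr_ge0 // ltW.
rewrite (_ : _ * _ * _ = (`|h| * e) * ((2 * n%:R * `|v|) / N)); last by rewrite /N; ring.
rewrite ler_piMr ?mulr_ge0 ?(ltW e0) // ler_pdivrMr // mul1r /N lerDl //.
Unshelve. all: by end_near. Qed.

End InverseFunction.

Section InverseFunctionTheorem.
Variables (R : realType) (n : nat).
Notation V := 'rV[R]_n.

Lemma near1_unitmx (P : 'M[R]_n) e : 0 <= e -> n%:R * e < 1 ->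
  (forall i j, `|P i j - 1%:M i j| <= e) -> P \in unitmx.
Proof.
move=> e0 ne HP; rewrite -row_free_unit; apply: inj_row_free => v vP.
have : `|v *m (P - 1%:M)| <= n%:R * e * `|v|.
  by apply: mulmx_norm_le => // i j; rewrite 2!mxE; exact: HP.
rewrite mulmxBr vP mulmx1 sub0r normrN => H.
apply/eqP; rewrite -normr_le0; rewrite leNgt; apply/negP => v0.
by move: H; rewrite leNgt gtr_pMl // ne.
Qed.

(** Bootstrapping: the derivative of [G] is the inverse matrix of the Jacobian of
    [F] at [G], so it is as smooth as [G] itself. *)
Lemma ck_inverse (U W : set V) (F G : V -> V) k :
  open U -> (forall k, ck k U F) -> open W ->
  (forall z, W z -> U (G z) /\ F (G z) = z) ->
  (forall z z', W z -> W z' -> `|G z - G z'| <= 2 * `|z - z'|) ->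
  (forall z, W z -> partials F (G z) \in unitmx) -> ck k W G.
Proof.
move=> oU ckF oW FG lipG uP.
have cG : {in W, continuous G}.
  move=> z; rewrite inE => Wz.
  suff H : forall e : R, 0 < e -> \forall x \near z, `|G z - G x| < e.
    exact: ((@cvgrPdist_lt _ _ _ (nbhs z) _ G (G z)).2 H).
  move=> e e0.
  have : \forall x \near z, W x /\ ball z (e / 2) x.
    apply: filterI (open_nbhs_nbhs (conj oW Wz)) _.
    by apply: nbhsx_ballx; rewrite divr_gt0.
  apply: filterS => x [Wx]; rewrite -ball_normE /ball_ /= => H.
  by apply: le_lt_trans (lipG _ _ Wz Wx) _; lra.
have dG z j Wz := derivable_inverse (delta_mx 0 j) oU (ckF 1%N) oW FG lipG Wz (uP z Wz).
elim: k => [|k IH]; first by split.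
split=> // j; split=> [x|]; first by rewrite inE => /(dG _ j)[].
apply: (eq_ck (f := fun z => delta_mx 0 j *m invmx (partials F (G z)))) => //.
  by move=> z /(dG _ j)[_ ->].
apply/ck_rowP => // i.
rewrite (_ : (fun x => _) = (fun x => invmx (partials F (G x)) j i)); last first.
  by apply/funext => x; rewrite -rowE mxE.
apply: ck_invmx => // a b.
rewrite (_ : (fun x => _) = (fun x => ('D_(delta_mx 0 a) F \o G) x 0 b)); last first.
  by apply/funext => x; rewrite mxE.
apply: (ck_rowP _ _ oW).1.
by apply: ck_comp oW oU _ IH (ck_derive a (ckF k.+1)) => z /FG[].
Qed.

(** The map [x |-> y + x - F x] is a contraction near [x0] because [F] has
    Jacobian 1 there; its fixed points solve [F x = y].  Normalizing the Jacobian
    to 1 loses nothing, since the maps of interest can be composed with a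
    linear one. *)
Theorem inverse_function (U : set V) (F : V -> V) x0 :
  open U -> U x0 -> (forall k, ck k U F) -> partials F x0 = 1%:M ->
  exists (r : R) (W : set V) (G : V -> V),
  [/\ 0 < r, ball x0 r `<=` U,
     forall x y, ball x0 r x -> ball x0 r y -> F x = F y -> x = y &
     forall x, ball x0 r x -> partials F x \in unitmx] /\
  [/\ open W, W (F x0), forall y, W y -> ball x0 r (G y) /\ F (G y) = y &
      forall k, ck k W G].
Proof.
move=> oU Ux0 ckF F1.
(* Entrywise precision [e] on the Jacobian makes [x - F x] Lipschitz with
   constant [n e <= 1 / 2]. *)
pose e : R := (2 * (n%:R + 1))^-1.
have n10 : 0 < n%:R + 1 :> R by rewrite ltr_wpDl.
have e0 : 0 < e by rewrite invr_gt0 mulr_gt0.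
have ne : n%:R * e <= 2^-1.
  rewrite /e invfM mulrCA ler_piMr ?invr_ge0 // ler_pdivrMr // mul1r; lra.
have [r [r0 rU [rP rF]]] := C1_strict oU Ux0 (ckF 1%N) e0.
have lip x y : ball x0 r x -> ball x0 r y ->
    `|F x - F y - (x - y)| <= 2^-1 * `|x - y|.
  move=> bx yb; have := rF x y bx yb; rewrite F1 mulmx1 => H.
  by apply: le_trans H _; rewrite ler_wpM2r.
have uP x : ball x0 r x -> partials F x \in unitmx.
  move=> bx; apply: (near1_unitmx (ltW e0)); first by lra.
  by move=> i j; have := rP x bx i j; rewrite F1.
have lip2 x y : ball x0 r x -> ball x0 r y -> `|x - y| <= 2 * `|F x - F y|.
  move=> bx yb; have H := lip _ _ bx yb.
  have := ler_normB (F x - F y) (F x - F y - (x - y)).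
  have -> : F x - F y - (F x - F y - (x - y)) = x - y by rewrite subKr.
  by lra.
pose W := ball (F x0) (r / 4).
pose D := closed_ball x0 (r / 2).
have DE : D = [set x | `|x0 - x| <= r / 2] by rewrite /D closed_ballE // divr_gt0.
have Dball x : D x -> ball x0 r x.
  by rewrite DE -ball_normE /ball_ /= => H; apply: le_lt_trans H _; lra.
have ex y : W y -> exists x, ball x0 r x /\ F x = y.
  move=> Wy.
  have [||||x Dx xE] := @fixed_point R n D (fun x => y + x - F x).
  - exact: closed_ball_closed.
  - by exists x0; rewrite DE /= subrr normr0 divr_ge0 // ltW.
  - move=> x Dx; have bx := Dball _ Dx; move: Dx; rewrite DE /= => Dx.
    have := lip _ _ (ballxx _ r0) bx; move: Wy; rewrite /W -ball_normE /ball_ /= => Wy H.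
    have -> : x0 - (y + x - F x) = (F x0 - y) - (F x0 - F x - (x0 - x)).
      by apply/rowP => j; rewrite !mxE; ring.
    by apply: le_trans (ler_normB _ _) _; lra.
  - move=> x x' /Dball bx /Dball bx'; have := lip _ _ bx bx'.
    have -> : y + x - F x - (y + x' - F x') = - (F x - F x' - (x - x')).
      by apply/rowP => j; rewrite !mxE; ring.
    by rewrite normrN.
  exists x; split; first exact: Dball.
  by apply/eqP; rewrite eq_sym -subr_eq0; apply/eqP/(addIr x); rewrite add0r addrAC -xE.
pose G y := xget x0 [set x | ball x0 r x /\ F x = y].
have GP y : W y -> ball x0 r (G y) /\ F (G y) = y.
  by move=> /ex[x H]; rewrite /G; case: xgetP => [z -> []|/(_ x)].
exists r, W, G; split; split=> //.
- move=> x y bx yb Fxy; have := lip2 _ _ bx yb; rewrite Fxy subrr normr0 mulr0.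
  by rewrite normr_le0 subr_eq0 => /eqP.
- exact: ball_open.
- by apply: ballxx; rewrite divr_gt0.
- move=> k; apply: (@ck_inverse (ball x0 r) W F G k) => //.
  + exact: ball_open.
  + by move=> j; exact: sub_ck rU (ckF j).
  + exact: ball_open.
  + move=> z z' /GP[bz Fz] /GP[bz' Fz'].
    by have := lip2 _ _ bz bz'; rewrite Fz Fz'.
  + by move=> z /GP[bz _]; exact: uP.
Qed.

End InverseFunctionTheorem.

(** * Injective smooth maps have full rank somewhere *)

Section RankArgument.
Variable R : realType.

Lemma partials_linear n m (A : 'M[R]_(n, m)) x :
  partials (fun x : 'rV[R]_n => x *m A) x = A.
Proof.
have linL : linear (fun v : 'rV[R]_n => v *m A).
  by move=> a u v; rewrite mulmxDl -scalemxAl.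
pose L : {linear 'rV[R]_n -> 'rV[R]_m} :=
  HB.pack (fun v : 'rV[R]_n => v *m A) (GRing.isLinear.Build _ _ _ _ _ linL).
apply/matrixP => i j; rewrite mxE.
have [_ ->] := is_derive_linear L x (delta_mx 0 i).
by rewrite /L /= -rowE mxE.
Qed.

Lemma partialsM_linear n m p (U : set 'rV[R]_n) (f : 'rV[R]_n -> 'rV[R]_m)
   (A : 'M[R]_(m, p)) x : U x -> ck 1 U f ->
  partials (fun x => f x *m A) x = partials f x *m A.
Proof.
move=> Ux ckf; apply/row_matrixP => i; rewrite row_mul.
have -> : row i (partials f x) = 'D_(delta_mx 0 i) f x by apply/rowP => k; rewrite !mxE.
apply/rowP => j; rewrite mxE [LHS]mxE.
have ckA : ck 1 setT (fun y : 'rV[R]_m => y *m A).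
  by apply: ck_mulmxr; [exact: openT|apply: ck_id; exact: openT].
have [_ ->] := derivable_comp (U := setT) openT I ckA (ck_derivable (j := i) ckf Ux).
by rewrite partials_linear.
Qed.

Lemma exists_max_rank n m (T : Type) (U : set T) (J : T -> 'M[R]_(n, m)) :
  U !=set0 -> exists2 x0, U x0 & forall x, U x -> (\rank (J x) <= \rank (J x0))%N.
Proof.
move=> [x1 Ux1]; pose P r := `[< exists2 x, U x & \rank (J x) = r >].
have exP : exists r, P r by exists (\rank (J x1)); apply/asboolP; exists x1.
have ubP r : P r -> (r <= n)%N by move=> /asboolP[x _ <-]; exact: rank_leq_row.
case: (ex_maxnP exP ubP) => r /asboolP[x0 Ux0 <-] H; exists x0 => // x Ux.
by apply: H; apply/asboolP; exists x.
Qed.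

Lemma constant_along_line n m (f : 'rV[R]_n -> 'rV[R]_m) y w (t : R) :
  0 <= t -> (forall s, 0 <= s <= t -> derivable f (y + s *: w) w /\ 'D_w f (y + s *: w) = 0) ->
  f (y + t *: w) = f y.
Proof.
move=> t0 H; apply/rowP => j; pose g s := f (y + s *: w) 0 j.
have dg s : s \in `[0, t] -> is_derive s 1 g ((fun=> 0) s).
  rewrite in_itv /= => /H[df Df].
  have dfj : derivable (fun z => f z 0 j) (y + s *: w) w by exact: (derivable_mxP _ _ _).1.
  have := is_derive_line dfj.
  by move: Df; rewrite (derive_mx df) => /matrixP /(_ 0 j); rewrite !mxE => ->.
have [|c _] := @MVT_segment R g (fun=> 0) 0 t t0 (fun s sin => dg s (subset_itv_oo_cc sin)).
  by apply: derivable_within_continuous => s /dg[].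
by rewrite mul0r => /subr0_eq; rewrite /g scale0r addr0.
Qed.

(** At a point [x0] of maximal rank, choose a generalized inverse [A] of the
    Jacobian [J0] and put [E = J0 A], a projection.  The map
    [F x = f x A + x (1 - E)] has Jacobian 1 at [x0].  If [E <> 1], the inverse
    of [F] maps a line in direction [w] with [w E = 0] to a curve whose velocity
    is killed by [(partials f) A], hence by [partials f] by maximality of the
    rank; then [f] is constant along this curve, contradicting injectivity. *)
Lemma injective_full_rank n m (U : set 'rV[R]_n) (f : 'rV[R]_n -> 'rV[R]_m) :
  open U -> U !=set0 -> (forall k, ck k U f) ->
  (forall x y, U x -> U y -> f x = f y -> x = y) ->
  exists2 x0, U x0 & exists A, partials f x0 *m A = 1%:M.
Proof.
move=> oU U0 ckf injf.
have [x0 Ux0 rk] := exists_max_rank (partials f) U0.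
exists x0 => //; set J0 := partials f x0 in rk *.
have [Q JQJ] : exists Q, J0 *m Q *m J0 = J0.
  by exists (pinvmx J0); rewrite mulmxKpV.
(* [Q] is only an inner inverse; [A] also satisfies [A J0 A = A]. *)
pose A := Q *m J0 *m Q.
have JAE : J0 *m A = J0 *m Q by rewrite /A !mulmxA JQJ.
have JAJ : J0 *m A *m J0 = J0 by rewrite JAE JQJ.
have AJA : A *m (J0 *m A) = A.
  rewrite JAE /A; transitivity (Q *m (J0 *m Q *m J0) *m Q); last by rewrite JQJ.
  by rewrite !mulmxA.
set E := J0 *m A in JAJ AJA; exists A; rewrite -/E.
have EA : J0 *m A = E by [].
have EE : E *m E = E by rewrite {2}/E mulmxA JAJ.
clear JQJ JAE.
have JAE (J : 'M[R]_(n, m)) : (J *m A + (1%:M - E)) *m E = J *m A.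
  by rewrite mulmxDl mulmxBl mul1mx EE subrr addr0 -mulmxA AJA.
clearbody A E.
pose F x := f x *m A + x *m (1%:M - E).
have pF x : U x -> partials F x = partials f x *m A + (1%:M - E).
  move=> Ux; rewrite -(partialsM_linear A Ux (ckf 1%N)) -[X in _ = _ + X](partials_linear _ x).
  have d1 i : derivable (fun x => f x *m A) x (delta_mx 0 i).
    have ckfA : ck 1 U (fun x => f x *m A) by exact: ck_mulmxr.
    exact: ck_derivable ckfA Ux.
  have d2 i : derivable (fun x : 'rV[R]_n => x *m (1%:M - E)) x (delta_mx 0 i).
    have ckE : ck 1 U (fun x => x *m (1%:M - E)) by apply: ck_mulmxr => //; exact: ck_id.
    exact: ck_derivable ckE Ux.
  by apply/matrixP => i j; rewrite !mxE [in LHS]deriveD // mxE.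
have ckF k : ck k U F.
  apply: ckD => //; first exact: ck_mulmxr.
  by apply: ck_mulmxr => //; exact: ck_id.
have F1 : partials F x0 = 1%:M by rewrite pF // -/J0 EA addrC subrK.
have [r [W [G [[r0 rU Finj Funit] [oW WF FG ckG]]]]] := inverse_function oU Ux0 ckF F1.
apply/eqP; apply: contrapT => /negP E1.
have [i wi0] : exists i, row i (1%:M - E) != 0.
  apply: contrapT => H; case/negP: E1; rewrite eq_sym -subr_eq0; apply/eqP/row_matrixP => i.
  rewrite row0; apply/eqP; apply: contrapT => /negP Hi; apply: H; by exists i.
set w := row i _ in wi0.
have wE : w *m E = 0 by rewrite /w -row_mul mulmxBl mul1mx EE subrr row0.
have UG y : W y -> U (G y) by move=> /FG[/rU].
have dfG y : W y -> derivable (f \o G) y w /\ 'D_w (f \o G) y = 0.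
  move=> Wy; have [bG FGy] := FG _ Wy; have UGy := UG _ Wy.
  have [dG _] := C1_differentiable oW Wy (ckG 1%N).
  have {}dG : derivable G y w by exact: diff_derivable.
  have [? ->] := derivable_comp oU UGy (ckf 1%N) dG; split=> //.
  have [_] := derivable_comp oU UGy (ckF 1%N) dG.
  set u := 'D_w G y.
  have -> : 'D_w (F \o G) y = w.
    rewrite -[RHS](derive_id y w); apply: near_eq_derive.
    by apply: (open_near_eq oW Wy) => z /FG[].
  have := Funit _ bG; rewrite pF //; set J := partials f (G y); set P := _ + _ => uP wP.
  (* The Jacobian [P] of [F] is invertible, so [J A] has the rank of [E], which
     is the maximal one: hence [J A] and [J] have the same kernel. *)
  have PE : P *m E = J *m A := JAE J.
  have uJA : u *m J *m A = 0 by rewrite -mulmxA -PE mulmxA -wP.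
  have rkJ : \rank (J *m A) = \rank J.
    apply/eqP; rewrite eqn_leq mxrankM_maxl /= -PE eqmxMfull ?row_full_unit //.
    by apply: leq_trans (rk _ UGy) _; rewrite -[J0 in X in (X <= _)%N]JAJ mxrankM_maxl.
  have /mxrank_injP/eqP H := rkJ.
  apply/eqP; rewrite -submx0 -H sub_capmx submxMl /=; exact/sub_kermxP.
have [t /= t0 tW] : exists2 t : R, 0 < t & forall s, 0 <= s <= t -> W (F x0 + s *: w).
  have /nbhs_ballP[rho /= rho0 rW] : nbhs (F x0) W by exact: open_nbhs_nbhs.
  have /nbhs_ballP[t /= t0 H] := near_line (F x0) w rho0.
  exists (t / 2); first by rewrite divr_gt0.
  move=> s /andP[s0 st]; apply: rW; rewrite addrC; apply: H.
  by rewrite /ball /= sub0r normrN ger0_norm //; lra.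
have fE : (f \o G) (F x0 + t *: w) = (f \o G) (F x0).
  by apply: (constant_along_line (ltW t0)) => s /tW /dfG.
have Wt : W (F x0 + t *: w) by apply: tW; rewrite lexx ltW.
have := injf _ _ (UG _ Wt) (UG _ WF) fE.
move=> /(congr1 F); have [_ ->] := FG _ Wt; have [_ ->] := FG _ WF.
move=> /eqP; rewrite -subr_eq0 addrAC subrr add0r scaler_eq0 (negPf wi0) orbF.
by rewrite gt_eqF.
Qed.

End RankArgument.

(** * Charts and smooth plots *)

Section Charts.
Variables (R : realType) (n : nat) (M : topologicalType) (c : chart R n M).
Hypothesis cP : is_chart c.

Lemma chartK x : cdom c x -> cinv c (cmap c x) = x.
Proof. by case: cP => _ _ K _ _ cx; apply: K; rewrite inE. Qed.

Lemma cimgP (W : set M) v : cimg c W v <-> cimg c setT v /\ W (cinv c v).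
Proof.
split=> [[x [cx Wx] <-]|[[x [cx _] <-]]].
  by rewrite chartK //; split=> //; exists x.
by rewrite chartK // => Wx; exists x.
Qed.

Lemma cinvP v : cimg c setT v -> cdom c (cinv c v) /\ cmap c (cinv c v) = v.
Proof. by move=> [x [cx _] <-]; rewrite chartK. Qed.

Lemma cimgT x : cdom c x -> cimg c setT (cmap c x).
Proof. by move=> cx; exists x. Qed.

Lemma cmap_inj x y : cdom c x -> cdom c y -> cmap c x = cmap c y -> x = y.
Proof. by move=> cx cy /(congr1 (cinv c)); rewrite !chartK. Qed.

Lemma open_cimg (W : set M) : open W -> open (cimg c W).
Proof.
move=> oW; have [_ oI _ _ cI] := cP.
rewrite (_ : cimg c W = cimg c setT `&` cinv c @^-1` W).
  exact: (continuous_inP _ oI).1.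
by apply/seteqP; split=> v /cimgP.
Qed.

Lemma open_cmap_preimage (V : set 'rV[R]_n) : open V -> open (cdom c `&` cmap c @^-1` V).
Proof. by move=> oV; have [oc _ _ cm _] := cP; apply: (continuous_inP _ oc).1. Qed.

Lemma cmap_continuous x : cdom c x -> {for x, continuous (cmap c)}.
Proof. by move=> cx; have [_ _ _ cm _] := cP; apply: cm; rewrite inE. Qed.

Lemma cinv_continuous v : cimg c setT v -> {for v, continuous (cinv c)}.
Proof. by move=> cv; have [_ _ _ _ ci] := cP; apply: ci; rewrite inE. Qed.

End Charts.

Lemma near_eq_continuous (S T : topologicalType) (f g : S -> T) x :
  (\forall y \near x, f y = g y) -> {for x, continuous f} -> {for x, continuous g}.
Proof.
move=> fg cf; have fgx : f x = g x by exact: nbhs_singleton fg.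
rewrite /prop_for /continuous_at -fgx.
by apply: cvg_trans cf; apply: near_eq_cvg.
Qed.

Section Plots.
Variable R : realType.

(** What is left of an atlas when smoothness of the transition maps is dropped;
    this suffices to push plots forward, so the product atlas only has to be
    shown to satisfy this. *)
Definition charts_atlas n (M : topologicalType) (A : set (chart R n M)) :=
  (forall c, A c -> is_chart c) /\ forall x, exists2 c, A c & cdom c x.

Definition plot_in N n (M : topologicalType) (c : chart R n M)
    (F : 'rV[R]_N -> M) (v : 'rV[R]_N) : Prop :=
  exists V, [/\ open V, V v, forall u, V u -> cdom c (F u) &
                forall k, ck k V (cmap c \o F)].

(** A map into a manifold, seen in one chart as a smooth map near [v].  Plots are
    stable under smooth maps, pairing and reparametrization, which replaces
    the choice of charts in all later smoothness proofs. *)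
Definition plot N n (M : topologicalType) (A : set (chart R n M))
    (F : 'rV[R]_N -> M) (v : 'rV[R]_N) : Prop :=
  exists2 c, A c & plot_in c F v.

Section OneMap.
Variables (N n m : nat) (M M' : topologicalType).
Variables (A : set (chart R n M)) (B : set (chart R m M')).
Hypothesis (HA : charts_atlas A) (HB : charts_atlas B).
Implicit Types (F : 'rV[R]_N -> M) (f : M -> M') (v : 'rV[R]_N).

(** The target chart [d] is arbitrary here: for [f = id] this is independence of
    the chart in the definition of plots. *)
Lemma plot_in_map f F v d : smooth_wrt A B f -> plot A F v -> B d ->
  cdom d (f (F v)) -> plot_in d (f \o F) v.
Proof.
move=> [cf sf] [c Ac [V [oV Vv VF ckF]]] Bd dv.
have cc := HA.1 _ Ac; have cd := HB.1 _ Bd.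
(* On [S] the coordinate expression of [f] is smooth, and [F] stays in the
   part of its chart that is mapped to [S] for nearby arguments. *)
set S := cimg c (f @^-1` cdom d).
have oS : open S.
  apply: open_cimg => //; apply: (continuousP f).1 => //.
  by case: cd.
exists (V `&` (cmap c \o F) @^-1` S); split.
- by apply: (continuous_inP _ oV).1 => //; have [] := ckF 0%N.
- by split=> //; exists (F v) => //; split=> //; apply: VF.
- move=> u [Vu [x [cx dx] xE]].
  by rewrite /= -(cmap_inj cc cx (VF _ Vu) xE).
move=> k; have oVS : open (V `&` (cmap c \o F) @^-1` S).
  by apply: (continuous_inP _ oV).1 => //; have [] := ckF 0%N.
apply: (eq_ck (f := (cmap d \o f \o cinv c) \o (cmap c \o F))) => //.
  by move=> u [Vu _] /=; rewrite chartK //; exact: VF.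
apply: (ck_comp (U' := S)) => //; first by move=> u [].
  by apply: sub_ck (ckF k) => u [].
by rewrite ckE; exact: sf.
Qed.

Lemma plot_map f F v : smooth_wrt A B f -> plot A F v -> plot B (f \o F) v.
Proof.
move=> sf pF; have [d Bd dv] := HB.2 (f (F v)).
by exists d => //; exact: plot_in_map pF _ _.
Qed.

Lemma plot_continuous F v : plot A F v -> {for v, continuous F}.
Proof.
move=> [c Ac [V [oV Vv VF ckF]]]; have cc := HA.1 _ Ac.
apply: (near_eq_continuous (f := cinv c \o (cmap c \o F))).
  by apply: filterS (open_nbhs_nbhs (conj oV Vv)) => u Vu /=; rewrite chartK //; exact: VF.
apply: continuous_comp; first exact: ck_continuous (ckF 0%N) Vv.
by apply: cinv_continuous => //; apply: cimgT; exact: VF.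
Qed.

Lemma plot_cst a v : plot A (cst a) v.
Proof.
have [c Ac ca] := HA.2 a; exists c => //; exists setT; split=> //; first exact: openT.
by move=> k; exact: (ck_cst k setT (cmap c a)).
Qed.

Lemma eq_plot F F' (V : set 'rV[R]_N) v : open V -> V v -> (forall u, V u -> F u = F' u) ->
  plot A F v -> plot A F' v.
Proof.
move=> oV Vv FF' [c Ac [V' [oV' V'v VF ckF]]]; exists c => //.
have oI : open (V `&` V') by exact: openI.
exists (V `&` V'); split=> // [u [Vu V'u]|k]; first by rewrite -FF' //; exact: VF.
apply: (eq_ck (f := cmap c \o F)) => // [u [Vu _]|]; first by rewrite /= FF'.
by apply: sub_ck (ckF k) => u [].
Qed.

End OneMap.

Lemma plot_comp N p n (M : topologicalType) (A : set (chart R n M))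
  (F : 'rV[R]_N -> M) (h : 'rV[R]_p -> 'rV[R]_N) (U : set 'rV[R]_p) u :
  open U -> U u -> (forall k, ck k U h) -> plot A F (h u) -> plot A (F \o h) u.
Proof.
move=> oU Uu ckh [c Ac [V [oV Vv VF ckF]]]; exists c => //.
have oI : open (U `&` h @^-1` V).
  by apply: (continuous_inP _ oU).1 => //; have [] := ckh 0%N.
exists (U `&` h @^-1` V); split=> // [z [_ /VF]//|k].
apply: (ck_comp (U' := V) (f := cmap c \o F)) => //; first by move=> z [].
by apply: sub_ck (ckh k) => z [].
Qed.

Lemma plot_cinv n (M : topologicalType) (A : set (chart R n M)) c v :
  charts_atlas A -> A c -> cimg c setT v -> plot A (cinv c) v.
Proof.
move=> HA Ac cv; have cc := HA.1 _ Ac; exists c => //.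
have oI := open_cimg cc openT.
exists (cimg c setT); split=> // [u /(cinvP cc)[]//|k].
by apply: (eq_ck (f := id)) (ck_id k oI) => // u /(cinvP cc)[].
Qed.

Lemma smooth_wrt_id n (M : topologicalType) (A : set (chart R n M)) :
  is_smooth_atlas A -> smooth_wrt A A id.
Proof. by move=> [_ _ trA]; split=> [x|c d Ac Ad]; [exact: cvg_id|exact: trA]. Qed.

Lemma smooth_of_plots n m (M M' : topologicalType)
  (A : set (chart R n M)) (B : set (chart R m M')) (f : M -> M') :
  is_smooth_atlas A -> is_smooth_atlas B ->
  (forall c v, A c -> cimg c setT v -> plot B (f \o cinv c) v) -> smooth_wrt A B f.
Proof.
move=> [chA covA _] smB pf; have idB := smooth_wrt_id smB.
have [chB covB _] := smB; have HB : charts_atlas B by [].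
split=> [x|c d Ac Bd k].
  have [c Ac cx] := covA x; have cc := chA _ Ac.
  apply: (near_eq_continuous (f := (f \o cinv c) \o cmap c)).
    have oc : open (cdom c) by case: cc.
    by apply: filterS (open_nbhs_nbhs (conj oc cx)) => y cy /=; rewrite chartK.
  apply: continuous_comp; first exact: cmap_continuous.
  exact: (plot_continuous HB (pf c _ Ac (cimgT cx))).
rewrite -ckE; apply: ck_local => v vI; have cc := chA _ Ac.
have [vT dv] := (cimgP cc _ _).1 vI.
have [V [oV Vv _ ckV]] := plot_in_map HB HB idB (pf c v Ac vT) Bd dv.
by exists V => //; exact: ckV.
Qed.

Lemma prod_chartP n m (M M' : topologicalType) (c : chart R n M) (d : chart R m M') :
  is_chart c -> is_chart d -> is_chart (prod_chart c d).
Proof.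
move=> cc cd.
have [oc oic _ _ _] := cc; have [od oid _ _ _] := cd.
have imgE : cimg (prod_chart c d) setT =
    (lsubmx @^-1` cimg c setT) `&` (rsubmx @^-1` cimg d setT).
  apply/seteqP; split=> [_ [[x y] [[/= cx dy] _] <-]|v [[x [cx _] xv] [y [dy _] yv]]] /=.
    by rewrite row_mxKl row_mxKr; split; [exists x|exists y].
  by exists (x, y) => //=; rewrite xv yv hsubmxK.
split.
- apply: (@openI _ (fst @^-1` cdom c) (snd @^-1` cdom d)).
    by apply: (continuousP _).1 => // x; exact: cvg_fst.
  by apply: (continuousP _).1 => // x; exact: cvg_snd.
- rewrite imgE; apply: openI.
    by apply: (continuousP _).1 => //; exact: continuous_lsubmx.
  by apply: (continuousP _).1 => //; exact: continuous_rsubmx.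
- move=> [x y]; rewrite inE => -[/= cx dy].
  by rewrite row_mxKl row_mxKr !chartK.
- move=> [x y]; rewrite inE => -[/= cx dy].
  apply: continuous_mx => i j; case: (split_ordP j) => k ->.
    rewrite (_ : (fun y => _) = (fun v : 'rV[R]_n => v i k) \o (cmap c \o fst)); last first.
      by apply/funext => p /=; rewrite row_mxEl.
    apply: continuous_comp; last exact: coord_continuous.
    by apply: continuous_comp; [exact: cvg_fst|exact: cmap_continuous].
  rewrite (_ : (fun y => _) = (fun v : 'rV[R]_m => v i k) \o (cmap d \o snd)); last first.
    by apply/funext => p /=; rewrite row_mxEr.
  apply: continuous_comp; last exact: coord_continuous.
  by apply: continuous_comp; [exact: cvg_snd|exact: cmap_continuous].
- move=> v; rewrite inE imgE => -[/= vc vd].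
  have c1 : {for v, continuous (cinv c \o (@lsubmx R 1 n m))}.
    by apply: continuous_comp; [exact: continuous_lsubmx|exact: cinv_continuous].
  have c2 : {for v, continuous (cinv d \o (@rsubmx R 1 n m))}.
    by apply: continuous_comp; [exact: continuous_rsubmx|exact: cinv_continuous].
  exact: cvg_pair c1 c2.
Qed.

Lemma prod_atlasP n m (M M' : topologicalType)
  (A : set (chart R n M)) (B : set (chart R m M')) :
  charts_atlas A -> charts_atlas B -> charts_atlas (prod_atlas A B).
Proof.
move=> HA HB; split=> [_ [c [d [/HA.1 cc /HB.1 cd ->]]]|[x y]].
  exact: prod_chartP.
have [c Ac cx] := HA.2 x; have [d Bd dy] := HB.2 y.
by exists (prod_chart c d) => //; exists c, d.
Qed.

Lemma plot_pair N n m (M M' : topologicalType)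
  (A : set (chart R n M)) (B : set (chart R m M'))
  (F : 'rV[R]_N -> M) (F' : 'rV[R]_N -> M') v :
  plot A F v -> plot B F' v -> plot (prod_atlas A B) (fun u => (F u, F' u)) v.
Proof.
move=> [c Ac [V [oV Vv VF ckF]]] [d Bd [V' [oV' V'v VF' ckF']]].
have oI : open (V `&` V') by exact: openI.
exists (prod_chart c d); first by exists c, d.
exists (V `&` V'); split=> // [u [Vu V'u]|k].
  by split; [exact: VF|exact: VF'].
apply: ck_row_mx => //; first by apply: sub_ck (ckF k) => u [].
by apply: sub_ck (ckF' k) => u [].
Qed.

End Plots.

(** * Baire category on manifolds *)

Lemma dense_sequence (T : topologicalType) (t0 : T) : @second_countable T ->
  exists s : nat -> T, forall O : set T, open O -> O !=set0 -> exists i, O (s i).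
Proof.
move=> [B cB [oB basB]].
have [f fB] : exists f : nat -> set T, B `<=` range f.
  move/pfcard_geP: cB => [->|[f]]; first by exists (fun=> set0).
  by exists f; exact: surj.
exists (fun i => xget t0 (f i)) => O oO [x Ox].
have [U [BU Ux] UO] : filter_from [set U | B U /\ U x] id O.
  by apply: basB; exact: open_nbhs_nbhs.
have [i _ fi] := fB _ BU; exists i; apply: UO; rewrite fi /id.
by apply: xgetPex; exists x.
Qed.

(** The Baire property of R^n, transported through one chart: restricted to a
    closed ball inside the image of the chart, the complements of the sets
    [T k] cannot all be dense. *)
Lemma Baire_cover (R : realType) n (M : topologicalType) (A : set (chart R n M))
  (T : nat -> set M) (x : M) : charts_atlas A ->
  (forall k, closed (T k)) -> (forall y, exists k, T k y) ->
  exists k (W : set M), [/\ open W, W !=set0 & W `<=` T k].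
Proof.
move=> HA cT covT; have [c Ac cx] := HA.2 x; have cc := HA.1 _ Ac.
pose S := cimg c setT; have oS : open S := open_cimg cc openT.
have /nbhs_closedballP[rho rhoS] : nbhs (cmap c x) S.
  by apply: open_nbhs_nbhs; split=> //; exact: cimgT.
set D := closed_ball _ _ in rhoS.
(* Open, being the complement of a relatively closed subset of [D]; outside the
   image of the chart [cinv] has no meaning, whence the intersection
   with [S]. *)
pose F k := ~` D `|` (S `&` cinv c @^-1` (~` T k)).
have oF k : open (F k).
  apply: openU; first by rewrite openC; exact: closed_ball_closed.
  have [_ _ _ _ ci] := cc.
  by apply: (continuous_inP _ oS).1 => //; rewrite openC.
apply: contrapT => noW.
have dF k : dense (F k).
  apply: contrapT => /denseNE[Q [[z [oQ Qz]] QF]].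
  have QD y : Q y -> S y /\ T k (cinv c y).
    move=> Qy; have nF : ~ F k y by move=> Fy; suff : set0 y by []; rewrite -QF; split.
    have Dy : D y by apply: contrapT => nD; apply: nF; left.
    split; first exact: rhoS.
    by apply: contrapT => nT; apply: nF; right; split=> //; exact: rhoS.
  apply: noW; exists k, (cdom c `&` cmap c @^-1` Q); split.
  - exact: open_cmap_preimage.
  - exists (cinv c z); have [Iz _] := QD _ Qz; have [? zE] := cinvP cc Iz.
    by split=> //; rewrite /preimage /= zE.
  - by move=> y [cy /QD[_]]; rewrite chartK.
have [] := @Baire R 'rV[R]_n F (fun k => conj (oF k) (dF k)) (ball (cmap c x) rho%:num).
- by exists (cmap c x); exact: ballxx.
- exact: ball_open.
move=> z [bz Fz]; have [k Tk] := covT (cinv c z).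
case: (Fz k I); last by case.
by apply; apply: subset_closed_ball.
Qed.

(** * Factorizations of a Lie group *)

Section LieGroupPlots.
Variables (R : realType) (n : nat) (G : lieGroupType R n).
Notation atl := (@atlas R n G).

Lemma manifold_charts (m : nat) (M : manifoldType R m) : charts_atlas (@atlas R m M).
Proof. by have [? ? _] := @atlas_smooth R m M. Qed.

Lemma plot_mulg N (F F' : 'rV[R]_N -> G) v :
  plot atl F v -> plot atl F' v -> plot atl (fun u => (F u * F' u)%g) v.
Proof.
move=> pF pF'; have cG := @manifold_charts n G.
apply: (plot_map (prod_atlasP cG cG) cG lie_mul_smooth (plot_pair pF pF')).
Qed.

Lemma plot_invg N (F : 'rV[R]_N -> G) v :
  plot atl F v -> plot atl (fun u => (F u)^-1%g) v.
Proof.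
move=> pF; have cG := @manifold_charts n G.
exact: (plot_map cG cG lie_inv_smooth pF).
Qed.

Lemma continuous_mulg (T : topologicalType) (f g : T -> G) :
  continuous f -> continuous g -> continuous (fun x => (f x * g x)%g).
Proof.
move=> cf cg x.
apply: (@continuous_comp _ _ _ (fun x => (f x, g x)) (fun p : G * G => (p.1 * p.2)%g)).
  exact: cvg_pair (cf x) (cg x).
by have [cm _] := @lie_mul_smooth R n G; exact: cm.
Qed.

Lemma continuous_invg (T : topologicalType) (f : T -> G) :
  continuous f -> continuous (fun x => (f x)^-1%g).
Proof.
move=> cf x; apply: continuous_comp; first exact: cf.
by have [ci _] := @lie_inv_smooth R n G; exact: ci.
Qed.

End LieGroupPlots.

Section Factorization.
Variables (R : realType) (n k l : nat).
Variables (G : lieGroupType R n) (H1 : lieGroupType R k) (H2 : lieGroupType R l).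
Variables (phi1 : H1 -> G) (phi2 : H2 -> G).
Hypotheses (phi1M : {morph phi1 : x y / (x * y)%g}) (phi2M : {morph phi2 : x y / (x * y)%g}).
Hypotheses (inj1 : injective phi1) (inj2 : injective phi2).
Hypotheses (smooth1 : smooth phi1) (smooth2 : smooth phi2).
Hypothesis fact : forall g, exists a b, g = (phi1 a * phi2 b)%g.
Hypothesis triv : forall a b, phi1 a = phi2 b -> phi1 a = 1%g.

Lemma morph1 (H : groupType) (phi : H -> G) :
  {morph phi : x y / (x * y)%g} -> phi 1%g = 1%g.
Proof. by move=> M; apply: (mulgI (phi 1%g)); rewrite -M !mulg1. Qed.

Lemma morphV (H : groupType) (phi : H -> G) :
  {morph phi : x y / (x * y)%g} -> {morph phi : x / (x^-1)%g}.
Proof.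
by move=> M x; apply: (mulgI (phi x)); rewrite -M !mulgV (morph1 M).
Qed.

Lemma factorization_unique a b a' b' :
  (phi1 a * phi2 b)%g = (phi1 a' * phi2 b')%g -> a = a' /\ b = b'.
Proof.
move=> E.
have E1 : phi1 (a'^-1 * a)%g = phi2 (b' * b^-1)%g.
  rewrite phi1M phi2M (morphV phi1M) (morphV phi2M).
  by apply: (mulgI (phi1 a')); apply: (mulIg (phi2 b)); rewrite mulVKg E !mulgA mulgVK.
have E2 := triv E1.
have aE : (a'^-1 * a)%g = 1%g by apply: inj1; rewrite E2 (morph1 phi1M).
have bE : (b' * b^-1)%g = 1%g by apply: inj2; rewrite -E1 E2 (morph1 phi2M).
by split; [apply: (mulgI (a'^-1)%g); rewrite mulVg|apply: (mulIg (b^-1)%g); rewrite mulgV].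
Qed.

Lemma minus_partE a b :
  minus_part (range phi1) (range phi2) (phi1 a * phi2 b)%g = phi2 b.
Proof.
rewrite /minus_part; case: xgetP => [gm _ [[b' _ <-] [_ [a' _ <-]]]|/(_ (phi2 b))[]].
  by move=> /factorization_unique[_ ->].
by split; [exists b|exists (phi1 a) => //; exists a].
Qed.

(** By second countability, countably many translates [phi1 h O1] and
    [O2 phi2 h'] cover the two factors, so countably many translates of the
    closed set [C] cover [G], and one of them has an interior point. *)
Lemma product_has_interior (O1 : set H1) (O2 : set H2) (C : set G) :
  open O1 -> O1 !=set0 -> open O2 -> O2 !=set0 -> closed C ->
  (forall a b, O1 a -> O2 b -> C (phi1 a * phi2 b)%g) ->
  exists S : set G, [/\ open S, S !=set0 & S `<=` C].
Proof.
move=> oO1 [e1 O1e1] oO2 [e2 O2e2] closedC CO.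
have [s1 s1P] := dense_sequence 1%g (@manifold_second_countable R k H1).
have [s2 s2P] := dense_sequence 1%g (@manifold_second_countable R l H2).
(* [dec] enumerates the pairs of translations; the default value is junk. *)
pose dec p := odflt (0%N, 0%N) (unpickle p : option (nat * nat)).
pose T p : set G :=
  [set g | C ((phi1 (s1 (dec p).1))^-1 * g * (phi2 (s2 (dec p).2))^-1)%g].
have ctr (h h' : G) : continuous (fun g : G => (h * g * h')%g).
  apply: continuous_mulg; last exact: cst_continuous.
  by apply: continuous_mulg; [exact: cst_continuous|move=> x; exact: cvg_id].
have cT p : closed (T p).
  by apply: (continuous_closedP _).1 => //; exact: ctr.
have covT g : exists p, T p g.
  have [a [b ->]] := fact g.
  have [||i O1i] := s1P [set y | O1 (y^-1 * a)%g].
  - apply: (continuousP _).1 => //; apply: continuous_mulg; last exact: cst_continuous.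
    by apply: continuous_invg => x; exact: cvg_id.
  - by exists (a * e1^-1)%g; rewrite /= invgM invgK mulgVK.
  have [||j O2j] := s2P [set y | O2 (b * y^-1)%g].
  - apply: (continuousP _).1 => //; apply: continuous_mulg; first exact: cst_continuous.
    by apply: continuous_invg => x; exact: cvg_id.
  - by exists (e2^-1 * b)%g; rewrite /= invgM invgK mulVKg.
  exists (pickle (i, j)); rewrite /T /dec pickleK /=.
  by have := CO _ _ O1i O2j; rewrite phi1M phi2M (morphV phi1M) (morphV phi2M) !mulgA.
have [p [S [oS [g0 Sg0] ST]]] := Baire_cover 1%g (@manifold_charts R n G) cT covT.
move: ST; rewrite /T; move: (phi1 _) (phi2 _) => h1 h2 ST.
pose S' := (fun g => h1 * g * h2)%g @^-1` S.
have oS' : open S' by apply: (continuousP _).1 => //; exact: ctr.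
exists S'; split=> //.
  by exists (h1^-1 * g0 * h2^-1)%g; rewrite /S' /preimage /= !mulgA mulgV mul1g mulgVK.
by move=> g /ST /=; rewrite !mulgA mulgK mulVg mul1g.
Qed.

(** In charts around the unit elements the product map is an injective smooth map
    [M] between open subsets of R^(k+l) and R^n.  At a point [x0] where its
    Jacobian has a right inverse [A], the map
    [F = M A] has a smooth local inverse [Psi], and [u |-> Psi (u A)] inverts [M]
    itself once [A] is known to be injective. *)
Lemma local_section : exists d v0 (beta : 'rV[R]_n -> H2) V,
  [/\ @atlas R n G d, open V, V v0, plot (@atlas R l H2) beta v0 &
   forall u, V u -> cimg d setT u /\ exists a, cinv d u = (phi1 a * phi2 (beta u))%g].
Proof.
have cG := @manifold_charts R n G.
have cH1 := @manifold_charts R k H1; have cH2 := @manifold_charts R l H2.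
have [c1 Ac1 c11] := cH1.2 1%g; have cc1 := cH1.1 _ Ac1.
have [c2 Ac2 c21] := cH2.2 1%g; have cc2 := cH2.1 _ Ac2.
pose m (v : 'rV[R]_(k + l)) := (phi1 (cinv c1 (lsubmx v)) * phi2 (cinv c2 (rsubmx v)))%g.
pose D := (lsubmx @^-1` cimg c1 setT) `&` (rsubmx @^-1` cimg c2 setT) : set 'rV[R]_(k + l).
have oD : open D.
  apply: openI.
    by apply: (continuousP _).1; [exact: continuous_lsubmx|exact: (open_cimg cc1 openT)].
  by apply: (continuousP _).1; [exact: continuous_rsubmx|exact: (open_cimg cc2 openT)].
have ckl j : ck j setT (fun v : 'rV[R]_(k + l) => lsubmx v).
  by apply: ck_lsubmx; [exact: openT|apply: ck_id; exact: openT].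
have ckr j : ck j setT (fun v : 'rV[R]_(k + l) => rsubmx v).
  by apply: ck_rsubmx; [exact: openT|apply: ck_id; exact: openT].
have plot_m v : D v -> plot (@atlas R n G) m v.
  move=> [v1 v2]; apply: plot_mulg.
    apply: (plot_map cH1 cG smooth1 (F := cinv c1 \o lsubmx)).
    by apply: (plot_comp openT _ ckl) => //; exact: plot_cinv.
  apply: (plot_map cH2 cG smooth2 (F := cinv c2 \o rsubmx)).
  by apply: (plot_comp openT _ ckr) => //; exact: plot_cinv.
pose v1 : 'rV[R]_(k + l) := row_mx (cmap c1 1%g) (cmap c2 1%g).
have Dv1 : D v1 by rewrite /D /= row_mxKl row_mxKr; split; exact: cimgT.
have [d Ad dm] := cG.2 (m v1); have cd := cG.1 _ Ad.
have idG := smooth_wrt_id (@atlas_smooth R n G).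
have [V0 [oV0 V0v1 V0d ckM]] := plot_in_map cG cG idG (plot_m _ Dv1) Ad dm.
rewrite /= in V0d ckM.
pose U := V0 `&` D; have oU : open U by exact: openI.
pose M := cmap d \o m.
have ckMU j : ck j U M by apply: sub_ck (ckM j) => v [].
have injm u v : D u -> D v -> m u = m v -> u = v.
  move=> [u1 u2] [w1 w2] /factorization_unique[E1 E2].
  rewrite -[u]hsubmxK -[v]hsubmxK.
  have [_ <-] := cinvP cc1 u1; have [_ <-] := cinvP cc1 w1.
  have [_ <-] := cinvP cc2 u2; have [_ <-] := cinvP cc2 w2.
  by rewrite E1 E2.
have injM u v : U u -> U v -> M u = M v -> u = v.
  by move=> [V0u Du] [V0v Dv] /(cmap_inj cd (V0d _ V0u) (V0d _ V0v)); exact: injm.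
have U0 : U !=set0 by exists v1.
have [x0 Ux0 [A JA]] := injective_full_rank oU U0 ckMU injM.
pose F x := M x *m A.
have ckF j : ck j U F by apply: ck_mulmxr.
have F1 : partials F x0 = 1%:M by rewrite (partialsM_linear A Ux0 (ckMU 1%N)).
have [r [W [Psi [[r0 rU Finj _] [oW WF FPsi ckPsi]]]]] := inverse_function oU Ux0 ckF F1.
(* Granting injectivity of [A], [M (Psi (u A)) A = u A] gives
   [M (Psi (u A)) = u]. *)
suff freeA (w : 'rV[R]_n) : w *m A = 0 -> w = 0.
  have ckA (S : set 'rV[R]_n) j : open S -> ck j S (fun u : 'rV[R]_n => u *m A).
    by move=> oS; apply: ck_mulmxr => //; exact: ck_id.
  pose V := cimg d setT `&` (fun u => u *m A) @^-1` W.
  have oV : open V.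
    apply: openI; first exact: (open_cimg cd openT).
    by apply: (continuousP _).1 => //; exact: continuous_mulmxr.
  exists d, (M x0), (fun u => cinv c2 (rsubmx (Psi (u *m A)))), V; split=> //.
  - by split=> //; apply: cimgT => //; apply: V0d; case: Ux0.
  - have ckh j : ck j V (fun u => rsubmx (Psi (u *m A))).
      apply: ck_rsubmx => //; apply: (ck_comp (U' := W) (f := Psi)) => //.
        by move=> u [].
      exact: ckA.
    apply: (plot_comp (F := cinv c2) oV _ ckh).
      by split=> //; apply: cimgT => //; apply: V0d; case: Ux0.
    apply: plot_cinv => //.
    by have [/rU[_ []]] := FPsi _ WF.
  move=> u [du Wu]; split=> //.
  have [/rU[V0P DP] FP] := FPsi _ Wu.
  exists (cinv c1 (lsubmx (Psi (u *m A)))).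
  have ME : M (Psi (u *m A)) = u.
    by apply/subr0_eq/freeA; rewrite mulmxBl -/(F _) FP subrr.
  by rewrite -[in LHS]ME /M /= chartK //; exact: V0d.
(* A small compact cube [K] around [x0] has an image with interior.  That
   interior contains two points which differ by a multiple of [w], so they
   have the same image by [A] although [F] is injective on [K]. *)
move=> wA; apply: contrapT => w0.
pose K := closed_ball x0 (r / 2).
have r20 : 0 < r / 2 by rewrite divr_gt0.
have Kball x : K x -> ball x0 r x.
  rewrite /K closed_ballE // -ball_normE /closed_ball_ /ball_ /= => H.
  by apply: le_lt_trans H _; lra.
have KU x : K x -> U x by move=> /Kball/rU.
have compactK : compact K.
  apply: bounded_closed_compact; last exact: closed_ball_closed.
  exists (`|x0| + r); split=> [|c cr x]; first by rewrite num_real.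
  move=> /Kball; rewrite -ball_normE /ball_ /= => H.
  have := ler_normB x0 (x0 - x); rewrite opprB addrC subrK => ?; lra.
have closedmK : closed (m @` K).
  apply: compact_closed; first exact: manifold_hausdorff.
  apply: continuous_compact => //; apply: continuous_in_subspaceT => x.
  by rewrite inE => /KU[_ Dx]; exact: (plot_continuous cG (plot_m _ Dx)).
pose O1 := cdom c1 `&` cmap c1 @^-1` ball (lsubmx x0) (r / 2).
pose O2 := cdom c2 `&` cmap c2 @^-1` ball (rsubmx x0) (r / 2).
have oO1 : open O1 by apply: open_cmap_preimage => //; exact: ball_open.
have oO2 : open O2 by apply: open_cmap_preimage => //; exact: ball_open.
have [V0x0 [Dx01 Dx02]] := Ux0.
have O1n0 : O1 !=set0.
  exists (cinv c1 (lsubmx x0)); have [? E] := cinvP cc1 Dx01.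
  by split=> //; rewrite /preimage /= E; exact: ballxx.
have O2n0 : O2 !=set0.
  exists (cinv c2 (rsubmx x0)); have [? E] := cinvP cc2 Dx02.
  by split=> //; rewrite /preimage /= E; exact: ballxx.
have KO a b : O1 a -> O2 b -> (m @` K) (phi1 a * phi2 b)%g.
  move=> [c1a ba] [c2b bb]; exists (row_mx (cmap c1 a) (cmap c2 b)).
    apply: subset_closed_ball; split=> // i j.
    rewrite -[x0]hsubmxK; case: (split_ordP j) => j' ->.
      by rewrite !row_mxEl; case: ba.
    by rewrite !row_mxEr; case: bb.
  by rewrite /m row_mxKl row_mxKr !chartK.
have [S [oS [g Sg] SK]] := product_has_interior oO1 O1n0 oO2 O2n0 closedmK KO.
have oI : open (cimg d S) by exact: open_cimg.
have IK z : cimg d S z -> exists2 x, K x & M x = z.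
  by move=> [h [dh /SK[x Kx <-]] <-]; exists x.
have [z Iz] : cimg d S !=set0.
  have [x Kx xE] := SK _ Sg; exists (cmap d g); exists g => //; split=> //.
  by rewrite -xE; apply: V0d; have [] := KU _ Kx.
have /nbhs_ballP[rho /= rho0 rI] : nbhs z (cimg d S) by exact: open_nbhs_nbhs.
have /nbhs_ballP[t /= t0 Ht] := near_line z w rho0.
have t20 : t / 2 != 0 by rewrite gt_eqF // divr_gt0.
have Izt : cimg d S ((t / 2) *: w + z).
  apply/rI/Ht; rewrite /ball /= sub0r normrN ger0_norm ?divr_ge0 ?(ltW t0) //; lra.
have [x Kx xE] := IK _ Iz; have [x' Kx' x'E] := IK _ Izt.
have : F x = F x' by rewrite /F xE x'E mulmxDl -scalemxAl wA scaler0 add0r.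
move=> /(Finj _ _ (Kball _ Kx) (Kball _ Kx')) xx'.
apply: w0; move: x'E; rewrite -xx' xE => /eqP.
rewrite addrC -subr_eq0 opprD addrA subrr add0r oppr_eq0.
by rewrite scaler_eq0 (negPf t20) => /eqP.
Qed.

(** Given [g1], choose [p] and [q] with [p g1 q] equal to the base point of the
    local section; the factorization of [p g q] then determines that of
    [g]. *)
Lemma smooth_minus_partV :
  smooth (fun g : G => (minus_part (range phi1) (range phi2) g)^-1%g).
Proof.
have cG := @manifold_charts R n G; have cH2 := @manifold_charts R l H2.
have [d [v0 [beta [V [Ad oV Vv0 pbeta secP]]]]] := local_section.
have cd := cG.1 _ Ad.
apply: smooth_of_plots; [exact: atlas_smooth|exact: atlas_smooth|].
move=> c z Ac cz; have [dv0 [a0 g0E]] := secP _ Vv0.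
have [a1 [b1 g1E]] := fact (cinv c z).
pose p := phi1 (a0 * a1^-1)%g; pose q := phi2 (b1^-1 * beta v0)%g.
have pqE : (p * cinv c z * q)%g = cinv d v0.
  rewrite g0E g1E /p /q !phi1M !phi2M (morphV phi1M) (morphV phi2M) !mulgA.
  by rewrite mulgVK mulgK.
have pc : plot (@atlas R n G) (cinv c) z by exact: plot_cinv.
pose h0 u := (p * cinv c u * q)%g.
have ph0 : plot (@atlas R n G) h0 z.
  by apply: plot_mulg; [apply: plot_mulg => //|]; exact: plot_cst.
have idG := smooth_wrt_id (@atlas_smooth R n G).
have [dd0 dE0] := cinvP cd dv0.
have dh0 : cdom d (h0 z) by rewrite /h0 pqE.
have [V1 [oV1 V1z V1d ckh]] := plot_in_map cG cG idG ph0 Ad dh0.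
rewrite /= in V1d; pose h := cmap d \o h0.
have hz : h z = v0 by rewrite /h /= /h0 pqE.
have oI : open (V1 `&` h @^-1` V).
  by apply: (continuous_inP _ oV1).1 => //; have [] := ckh 0%N.
pose f u := (phi2 (beta (h u)) * q^-1)^-1%g.
apply: (eq_plot (F := f) oI).
- by split=> //; rewrite /preimage /= hz.
- move=> u [V1u Vu]; have [_ [a]] := secP _ Vu.
  rewrite [cinv d _]chartK //; last exact: V1d.
  rewrite /h0 => E.
  have -> : (f u) = (phi2 (beta (h u) * (b1^-1 * beta v0)^-1)%g)^-1%g.
    by rewrite phi2M (morphV phi2M).
  rewrite /= -(minus_partE ((a0 * a1^-1)^-1 * a)%g); congr ((minus_part _ _ _)^-1)%g.
  rewrite phi1M phi2M !(morphV phi1M) !(morphV phi2M) -/p -/q.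
  apply: (mulgI p); apply: (mulIg q); rewrite E.
  by rewrite !mulgA mulgV mul1g mulgVK.
apply: plot_invg; apply: plot_mulg; last exact: plot_cst.
apply: (plot_map cH2 cG smooth2 (F := beta \o h)).
by apply: (plot_comp oV1 V1z ckh); rewrite -/h hz.
Qed.

End Factorization.

(** * The Rota-Baxter map of a factorization *)

Local Open Scope classical_set_scope.
Local Open Scope group_scope.

Theorem lemma2p7 (R : realType) (n : nat) (G : lieGroupType R n)
    (Gplus Gminus : set G)
    (subGplus : lie_subgroup Gplus) (subGminus : lie_subgroup Gminus)
    (factG : forall g : G, exists gp gm : G,
       [/\ Gplus gp, Gminus gm & g = gp * gm])
    (trivI : Gplus `&` Gminus = [set 1]) :
  rota_baxter_lie_group (fun g : G => (minus_part Gplus Gminus g)^-1).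
Proof.
have [k [H1 [phi1 [phi1M inj1 [smooth1 _] E1]]]] := subGplus.
have [l [H2 [phi2 [phi2M inj2 [smooth2 _] E2]]]] := subGminus.
subst Gplus Gminus.
have fact g : exists a b, g = phi1 a * phi2 b.
  by have [_ [_ [[a _ <-] [b _ <-] ->]]] := factG g; exists a, b.
have triv a b : phi1 a = phi2 b -> phi1 a = 1.
  by move=> ab; have : [set 1] (phi1 a) by rewrite -trivI; split; [exists a|exists b].
have minusE := minus_partE phi1M phi2M inj1 inj2 triv.
split; first exact: smooth_minus_partV.
move=> g1 g2; have [a1 [b1 ->]] := fact g1; have [a2 [b2 ->]] := fact g2.
rewrite /Ad !minusE invgK -invgM -phi2M.
have -> : phi1 a1 * phi2 b1 * ((phi2 b1)^-1 * (phi1 a2 * phi2 b2) * phi2 b1) =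
          phi1 (a1 * a2) * phi2 (b2 * b1).
  by rewrite phi1M phi2M !mulgA mulgK.
by rewrite minusE.
Qed.
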